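(* Let $(\Gamma_j)_{j\in J}$ be a countable family of lattices in $G$ and let $(g_j)_{j\in J}\subset L^2(G)$. Suppose that $(T_\gamma g_j)_{j\in J,\gamma\in\Gamma_j}$ is a frame for $L^2(G)$, with lower frame bound $A_g>0$, satisfying the $1$-UCP. Then $$A_g\le\sum_{j\in J}\frac{1}{\operatorname{covol}(\Gamma_j)}\,|\hat g_j(\omega)|^2\qquad\text{for a.e. }\omega\in\widehat G.$$
   Context: $G$ is a second countable locally compact abelian group, written additively, with Haar measure $\mu_G$; $\widehat G$ is its dual group, with Haar measure $\mu_{\widehat G}$ normalized so that the Fourier transform $\hat f(\omega)=\int_G f(x)\overline{\langle x,\omega\rangle}\,dx$ extends to a unitary map $L^2(G)\to L^2(\widehat G)$. A lattice in $G$ is a discrete subgroup $\Gamma$ with $G/\Gamma$ compact; $\operatorname{covol}(\Gamma)$ is the $\mu_G$-measure of any fundamental domain of $\Gamma$ (a Borel set whose $\Gamma$-translates tile $G$ up to null sets). $T_\gamma f=f(\cdot-\gamma)$. A family $(\eta_i)_{i\in I}$ in a Hilbert space $\mathcal H$ is a frame with lower bound $A>0$ and upper bound $B$ if $A\|f\|^2\le\sum_i|\langle f,\eta_i\rangle|^2\le B\|f\|^2$ for all $f\in\mathcal H$. Fix a closed set $E\subset\widehat G$ of measure zero (the blind spot), and let $\mathcal D_E$ be the set of $f\in L^2(G)$ such that $\hat f\in L^\infty(\widehat G)$ and there is a compact $K\subset\widehat G\setminus E$ with $\hat f\mathbf 1_K=\hat f$ a.e. For $f\in\mathcal D_E$ put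 $w_{f;g,j}(x)=\sum_{\gamma\in\Gamma_j}|\langle T_xf,T_\gamma g_j\rangle|^2$ (a trigonometric polynomial on $G$) and $w_{f;g}(x)=\sum_{j\in J}w_{f;g,j}(x)\in[0,\infty]$, $x\in G$. $\mathcal A(G)$ is the space of almost periodic functions: those $f\in C_b(G)$ for which $\{T_xf:x\in G\}$ is relatively compact in the uniform norm. The mean of $f\in\mathcal A(G)$ is $M(f)=\lim_n\mu_G(H_n)^{-1}\int_{H_n}f\,d\mu_G$, for any sequence of open relatively compact sets $H_n$ with $\bigcup_nH_n=G$ and $\mu_G((x+H_n)\cap(G\setminus H_n))/\mu_G(H_n)\to0$ for all $x\in G$; the mean is independent of the sequence. The system $(T_\gamma g_j)_{j,\gamma}$ fulfills the $1$-UCP (unconditional convergence property) if for all $f\in\mathcal D_E$: $w_{f;g}\in\mathcal A(G)$, and for every $\varepsilon>0$ there is a finite $J'\subset J$ such that for all finite $J''$ with $J'\subset J''\subset J$, $M\big(|w_{f;g}-\sum_{j\in J''}w_{f;g,j}|\big)<\varepsilon$. *)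

(* Defs.v *)
From HB Require Import structures.
From mathcomp Require Import all_boot all_order all_algebra finmap.
From mathcomp Require Import complex.
From mathcomp Require Import all_classical all_reals all_analysis.

Set Implicit Arguments.
Unset Strict Implicit.
Unset Printing Implicit Defensive.

Import Order.TTheory GRing.Theory Num.Theory.
Import numFieldNormedType.Exports.

Local Open Scope classical_set_scope.
Local Open Scope ring_scope.

Local Notation normc := ComplexField.Normc.normc.

(* T with its Borel sigma-algebra. g_sigma_algebraType is not used directly since
   it asks for a pointedType, which a topologicalZmodType is not canonically. *)
Definition borel (T : Type) : Type := T.

Section borel_instances.
Variable T : topologicalZmodType.

Let opens : set (set T) := [set U | open U].

Let borelC (A : set T) : <<s opens >> A -> <<s opens >> (~` A).
Proof. by move=> sA; rewrite -setTD; exact: sigma_algebraCD. Qed.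

HB.instance Definition _ := Choice.copy (borel T) T.
HB.instance Definition _ := isPointed.Build (borel T) (0 : T).
HB.instance Definition _ := @isMeasurable.Build (sigma_display opens) (borel T)
  <<s opens >> (@sigma_algebra0 _ setT opens) borelC
  (@sigma_algebra_bigcup _ setT opens).

End borel_instances.

(* On a second countable locally compact Hausdorff group, regularity follows from
   finiteness on compact sets. *)
Definition haar_measure (R : realType) (T : topologicalZmodType)
    (mu : {measure set (borel T) -> \bar R}) : Prop :=
  [/\ forall (a : T) (A : set T), measurable (A : set (borel T)) ->
        mu ((+%R a) @` A) = mu A,
      forall K : set T, compact K -> (mu K < +oo)%E
    & forall U : set T, open U -> U !=set0 -> (0 < mu U)%E].

Section Dual.
Variables (R : realType) (G : topologicalZmodType).

(* G^ carries the compact-open topology and pointwise operations, written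
   additively. *)
Definition characters : set {compact-open, G -> R[i]^o} :=
  [set chi | [/\ continuous (chi : G -> R[i]^o),
                 forall x, `|chi x| = 1
               & forall x y, chi (x + y) = chi x * chi y]].

Definition dual : Type := set_type characters.

HB.instance Definition _ := Topological.copy dual (set_type characters).

Definition pairing (x : G) (omega : dual) : R[i] := set_val omega x.

Lemma dualP (omega : dual) : characters (set_val omega).
Proof. exact/set_mem/(valP omega). Qed.

Lemma dual_eq (chi psi : dual) : pairing^~ chi =1 pairing^~ psi -> chi = psi.
Proof. by move=> h; apply: val_inj; apply/funext. Qed.

Lemma norm_pairing x omega : `|pairing x omega| = 1.
Proof. by case: (dualP omega) => _ + _; exact. Qed.

Lemma pairing_neq0 x omega : pairing x omega != 0.
Proof. by rewrite -normr_gt0 norm_pairing. Qed.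

Lemma character1 : characters (fun=> 1).
Proof.
by split=> [x|x|x y]; [exact: cvg_cst|rewrite normr1|rewrite mulr1].
Qed.

Lemma characterV (chi : dual) : characters (fun x => (pairing x chi)^-1).
Proof.
have [c n m] := dualP chi; split=> [x|x|x y].
- by apply: (@cvgV _ _ (nbhs x) _ (set_val chi)) (c x); exact: pairing_neq0.
- by rewrite normfV n invr1.
- by rewrite /pairing m invfM.
Qed.

Lemma characterM (chi psi : dual) :
  characters (fun x => pairing x chi * pairing x psi).
Proof.
have [c n m] := dualP chi; have [c' n' m'] := dualP psi; split=> [x|x|x y].
- exact: (@cvgM _ _ (nbhs x) _ (set_val chi) (set_val psi) _ _ (c x) (c' x)).
- by rewrite normrM n n' mulr1.
- by rewrite /pairing m m' mulrACA.
Qed.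

Definition dual_zero : dual := SigSub (mem_set character1).
Definition dual_opp chi : dual := SigSub (mem_set (characterV chi)).
Definition dual_add chi psi : dual := SigSub (mem_set (characterM chi psi)).

Let dual_addA : associative dual_add.
Proof. by move=> a b c; apply: dual_eq => x; exact: mulrA. Qed.
Let dual_addC : commutative dual_add.
Proof. by move=> a b; apply: dual_eq => x; exact: mulrC. Qed.
Let dual_add0 : left_id dual_zero dual_add.
Proof. by move=> a; apply: dual_eq => x; exact: mul1r. Qed.
Let dual_addN : left_inverse dual_zero dual_opp dual_add.
Proof. by move=> a; apply: dual_eq => x; exact: mulVf (pairing_neq0 _ _). Qed.

HB.instance Definition _ :=
  GRing.isZmodule.Build dual dual_addA dual_addC dual_add0 dual_addN.

Let val_cts : continuous (set_val : dual -> {compact-open, G -> R[i]^o}).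
Proof. exact: (@initial_continuous (set_type characters) _ set_val). Qed.

Let nbhs_dual_near (o : dual) (K : set G) (e : R[i]) : compact K -> 0 < e ->
  \forall w \near o, forall y, K y -> `|pairing y o - pairing y w| < e.
Proof.
move=> cK e0; have [co _ _] := dualP o.
have /(compact_open_fam_compactP co _)/fam_cvgP/(_ K cK) := @val_cts o.
set f := set_val o => h.
pose E := [set xy : R[i]^o * R[i]^o | ball xy.1 e xy.2].
have FF := fmap_filter (set_val : dual -> G -> R[i]^o) (nbhs_filter o).
have := h FF FF [set g | forall y, K y -> E (f y, g y)].
apply; apply/uniform_nbhs.
exists [set xy : R[i]^o * R[i]^o | ball xy.1 e xy.2]; split=> //.
by rewrite -entourage_ballE; exists e.
Qed.

Let dual_sub_continuous : continuous (fun p : dual * dual => p.1 - p.2).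
Proof.
apply: (@continuous_comp_initial _ _ _
  (set_val : dual -> {compact-open, G -> R[i]^o})) => -[chi psi].
have [cts _ _] := dualP (chi - psi).
apply/(compact_open_fam_compactP cts _)/fam_cvgP => K cK.
move=> P /uniform_nbhs [E [entE EP]].
move: entE; rewrite -entourage_ballE => -[e /= e0 eE].
have e20 : 0 < e / 2 by rewrite divr_gt0.
exists ([set w | forall y, K y -> `|pairing y chi - pairing y w| < e / 2],
        [set w | forall y, K y -> `|pairing y psi - pairing y w| < e / 2]).
  by split; exact: nbhs_dual_near.
move=> [w w'] /= [Bw Bw']; apply: EP => y Ky /=; apply: eE.
have {}Bw := Bw y Ky; have {}Bw' := Bw' y Ky.
change (`|pairing y chi / pairing y psi - pairing y w / pairing y w'| < e).
have -> : pairing y chi / pairing y psi - pairing y w / pairing y w' =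
    (pairing y chi - pairing y w) / pairing y psi +
    pairing y w / pairing y psi / pairing y w' *
      (pairing y w' - pairing y psi).
  have p0 := pairing_neq0 y psi; have w0 := pairing_neq0 y w'.
  rewrite mulrBl mulrBr divfK// addrA [X in _ = _ - X]mulrAC divfK//.
  by rewrite subrK.
rewrite (le_lt_trans (ler_normD _ _))// [e]splitr ltrD//.
  by rewrite normrM normfV norm_pairing invr1 mulr1.
by rewrite !normrM !normfV !norm_pairing invr1 !mulr1 mul1r distrC.
Qed.

HB.instance Definition _ :=
  PreTopologicalNmodule_isTopologicalZmodule.Build dual dual_sub_continuous.

End Dual.

Section L2.
Context {R : realType} {d : measure_display} {T : measurableType d}.
Variable mu : {measure set T -> \bar R}.

Definition cmeasurable (f : T -> R[i]) : Prop :=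
  measurable_fun setT (fun x => complex.Re (f x)) /\
  measurable_fun setT (fun x => complex.Im (f x)).

Definition cintegral (f : T -> R[i]) : R[i] :=
  Complex (\int[mu]_x complex.Re (f x)) (\int[mu]_x complex.Im (f x)).

Definition L1 (f : T -> R[i]) : Prop :=
  cmeasurable f /\ (\int[mu]_x (normc (f x))%:E < +oo)%E.

Definition sqnorm2 (f : T -> R[i]) : \bar R :=
  \int[mu]_x (normc (f x) ^+ 2)%:E.

(* Elements of L2 are represented by everywhere defined measurable functions;
   equality of classes is equality almost everywhere. *)
Definition L2 (f : T -> R[i]) : Prop := cmeasurable f /\ (sqnorm2 f < +oo)%E.

Definition inner (f g : T -> R[i]) : R[i] :=
  cintegral (fun x => f x * conjc (g x)).

Definition ess_bounded (f : T -> R[i]) : Prop :=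
  cmeasurable f /\ exists M : R, {ae mu, forall x, normc (f x) <= M}.

Definition is_frame (I : choiceType) (D : set I) (eta : I -> T -> R[i])
    (A B : R) : Prop :=
  [/\ 0 < A, forall i, D i -> L2 (eta i)
    & forall f, L2 f ->
        (A%:E * sqnorm2 f <=
           \esum_(i in D) (normc (inner f (eta i)) ^+ 2)%:E <=
         B%:E * sqnorm2 f)%E].

End L2.

Section Fourier.
Context {R : realType} {G : topologicalZmodType}.
Variables (mu : {measure set (borel G) -> \bar R})
  (nu : {measure set (borel (dual R G)) -> \bar R}).

Definition fourier (f : G -> R[i]) (omega : dual R G) : R[i] :=
  cintegral mu (fun x : borel G => f x * conjc (pairing x omega)).

(* F is the unitary extension to L2 of the Fourier transform; its existence is
   the normalization of nu relative to mu, and F is determined by the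
   conditions below up to equality almost everywhere. *)
Definition is_plancherel_transform
    (F : (G -> R[i]) -> (dual R G -> R[i])) : Prop :=
  [/\ forall f, L2 mu f -> L2 nu (F f),
      forall f, L1 mu f -> L2 mu f ->
        {ae nu, forall omega, F f omega = fourier f omega},
      forall (a : R[i]) f g, L2 mu f -> L2 mu g ->
        {ae nu, forall omega,
           F (fun x => a * f x + g x) omega = a * F f omega + F g omega},
      forall f, L2 mu f -> sqnorm2 nu (F f) = sqnorm2 mu f
    & forall h, L2 nu h ->
        exists2 f, L2 mu f & {ae nu, forall omega, F f omega = h omega}].

End Fourier.

Definition translate (G : zmodType) (V : Type) (a : G) (f : G -> V) : G -> V :=
  fun x => f (x - a).

Section Lattice.
Context {R : realType} {G : topologicalZmodType}.
Variable mu : {measure set (borel G) -> \bar R}.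

Definition lattice (Gamma : zmodClosed G) : Prop :=
  (forall gamma : set_type [set` Gamma], open [set gamma]) /\
  compact [set: quotient_topology (Quotient.quot Gamma)].

Definition fundamental_domain (Gamma : zmodClosed G) (D : set (borel G)) :
    Prop :=
  [/\ measurable D,
      mu.-negligible (~` \bigcup_(gamma in [set` Gamma]) ((+%R gamma) @` D))
    & forall gamma gamma', gamma \in Gamma -> gamma' \in Gamma ->
        gamma != gamma' ->
        mu.-negligible (((+%R gamma) @` D) `&` ((+%R gamma') @` D))].

(* xget picks an arbitrary fundamental domain; the measure does not depend on
   which. *)
Definition covol (Gamma : zmodClosed G) : R :=
  fine (mu (xget set0 (fundamental_domain Gamma))).

End Lattice.

Section AlmostPeriodic.
Context {R : realType} {G : topologicalZmodType}.

(* For a bounded continuous f, relative compactness of the orbit in C_b(G) and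
   in the space of all functions are the same, C_b(G) being uniformly closed. *)
Definition almost_periodic (K : numFieldType) (f : G -> K) : Prop :=
  [/\ continuous f, exists M : K, forall x, `|f x| <= M
    & precompact [set (translate a f : {uniform G -> K}) | a in [set: G]]].

Variable mu : {measure set (borel G) -> \bar R}.

Definition averaging_sequence (H : nat -> set G) : Prop :=
  [/\ forall n, [/\ open (H n), precompact (H n) & H n !=set0],
      \bigcup_n H n = [set: G]
    & forall x : G,
        fine (mu (((+%R x) @` H n) `&` ~` H n)) / fine (mu (H n))
          @[n --> \oo] --> (0 : R)].

(* A relation rather than a function, to avoid a default value for functions
   without a mean. Every almost periodic f has exactly one mean. *)
Definition is_mean (f : G -> R) (m : R) : Prop :=
  forall H, averaging_sequence H ->
    (fine (mu (H n)))^-1 * (\int[mu]_(x in (H n : set (borel G))) f x)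
      @[n --> \oo] --> m.

End AlmostPeriodic.

Section UCP.
Context {R : realType} {G : topologicalZmodType}.
Variables (mu : {measure set (borel G) -> \bar R})
  (nu : {measure set (borel (dual R G)) -> \bar R})
  (F : (G -> R[i]) -> (dual R G -> R[i])) (E : set (dual R G)).

Definition blind_class (f : G -> R[i]) : Prop :=
  [/\ L2 mu f, ess_bounded nu (F f)
    & exists K : set (dual R G), [/\ compact K, K `<=` ~` E
        & {ae nu, forall omega, F f omega * \1_K omega = F f omega}]].

Variables (J : countType) (Gamma : J -> zmodClosed G) (g : J -> G -> R[i]).

Definition wfunj (f : G -> R[i]) (j : J) (x : G) : \bar R :=
  \esum_(gamma in [set` Gamma j])
    (normc (inner mu (translate x f) (translate gamma (g j))) ^+ 2)%:E.

Definition wfun (f : G -> R[i]) (x : G) : \bar R :=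
  \esum_(j in [set: J]) wfunj f j x.

Definition ucp1 : Prop :=
  forall f, blind_class f ->
    [/\ forall x, wfun f x \is a fin_num,
        almost_periodic (fun x => fine (wfun f x))
      & forall eps : R, 0 < eps ->
          exists J' : {fset J}, forall J'' : {fset J}, (J' `<=` J'')%fset ->
            exists2 m : R,
              is_mean mu
                (fun x => fine `|wfun f x - \sum_(j <- J'') wfunj f j x|%E) m
              & m < eps].

End UCP.

(* Main.v *)
Require Import Defs.
From HB Require Import structures.
From mathcomp Require Import all_boot all_order all_algebra finmap.
From mathcomp Require Import complex.
From mathcomp Require Import all_classical all_reals all_analysis.
From mathcomp Require Import measurable_realfun.
From mathcomp Require Import ring lra.

Set Implicit Arguments.
Unset Strict Implicit.
Unset Printing Implicit Defensive.

Import Order.TTheory GRing.Theory Num.Theory.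
Import numFieldNormedType.Exports.

Local Open Scope classical_set_scope.
Local Open Scope ring_scope.

(** Why the bound holds.  For f in the test class, the frame inequality applied to
    T_x f reads A |f|^2 <= w_f(x) for every x, where w_f = sum_j w_(f,j).  Averaging
    over x along a Folner sequence H_n and using the 1-UCP, the average of w_f is, up
    to epsilon, the sum of the averages of finitely many w_(f,j).

    Each w_(f,j) is the Gamma_j-periodization of phi_j(x) = |<T_x f, g_j>|^2.
    Unfolding the periodization bounds its average over H_n by the integral of phi_j
    times the largest density of Gamma_j in a translate of H_n, and packing
    translates of a tile of Gamma_j into H_n + U bounds that density by about
    1 / covol (periodized_average, average_wfunj).  By Plancherel the integral of
    phi_j is that of |F f|^2 |F g_j|^2.  Only functions f whose transform is the
    indicator of a set Z are tested (correlation_energy), and this gives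
      A nu(Z) <= int_Z sum_j |F g_j|^2 / covol(Gamma_j)       (mean_inequality)
    for every measurable Z inside a compact set disjoint from E, and taking for Z the
    part of such a compact set where the sum is below A forces nu(Z) = 0.  The
    complement of the null set E is a countable union of compact sets
    (open_dual_sigma_compact), so the exceptional set is null.

    Four facts of harmonic analysis are proved on the way.
    - Folner sequences exist: U + U is covered by finitely many translates of U, so
      the measure of the k-fold sum kU grows polynomially in k and
      mu((k+1)U) <= (1 + eps) mu(kU) for some k (multset_folner).  Taking H_n = kU_n
      also controls H_n + U_n, uniformly, and this is what the density bound uses.
    - A lattice has a relatively compact Borel tile, whose measure dominates the
      covolume computed from any fundamental domain (lattice_tile, covol_bounds).
    - The dual is sigma-compact: characters within distance 1 of 1 on a neighbourhood
      of 0 form a compact set, since angle doubling makes them equicontinuous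
      (compact_near_trivial).
    - F turns translations into modulations (plancherel_translate), and
      x |-> <g, T_x f> is the inverse transform of F g times the conjugate of F f.
      The latter is tested against indicators of sets of finite measure and reduces
      to Fubini's theorem (inverse_transform_test). *)

(** * Countable sums of nonnegative functions *)

Section CountableSums.
Context {d : measure_display} {T : measurableType d} {R : realType}.
Variable mu : {measure set T -> \bar R}.

(** Monotone convergence and countable subadditivity are statements about series;
    this carries them over to sums over an abstract countable index set. *)
Lemma esum_countable_series (I : choiceType) (D : set I) : countable D ->
  exists2 e : nat -> option I,
    (forall n i, e n = Some i -> D i) /\ (forall i, D i -> exists n, e n = Some i) &
    forall a : I -> \bar R, (forall i, 0 <= a i)%E ->
      \esum_(i in D) a i = (\sum_(n <oo) oapp a 0 (e n))%E.
Proof.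
move=> /countable_injP[f finj].
have [->|/set0P[i0 Di0]] := eqVneq D set0.
  exists (fun=> None) => [|a a0]; first by split.
  by rewrite esum_set0 /= eseries0.
pose g n := xget i0 (D `&` f @^-1` [set n]).
have gP n : (f @` D) n -> (D `&` f @^-1` [set n]) (g n).
  move=> [i Di fi]; rewrite /g.
  by apply: (@xgetPex _ i0 (D `&` f @^-1` [set n])); exists i.
have gf i : D i -> g (f i) = i.
  move=> Di; have /gP[Dg /= fg] : (f @` D) (f i) by exists i.
  by apply: finj => //; apply/mem_set.
exists (fun n => if n \in f @` D then Some (g n) else None) => [|a a0].
  split=> [n i|i Di]; first by case: ifPn => // /set_mem /gP[Dg _] [<-].
  by exists (f i); rewrite mem_set ?gf//; exists i.
rewrite (@reindex_esum _ _ _ (f @` D) D g).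
  rewrite nneseries_esumT; last by move=> n; case: ifPn => /=.
  rewrite esum_mkcond; apply: eq_esum => n _.
  by case: ifPn.
split.
- by move=> n /gP[].
- by move=> n m /set_mem/gP[_ /= fn] /set_mem/gP[_ /= fm] ge; rewrite -fn ge.
- by move=> i Di /=; exists (f i); [exists i|exact: gf].
Qed.

Lemma esum_countableZl (I : choiceType) (D : set I) (a : I -> \bar R) (c : R) :
  countable D -> (forall i, 0 <= a i)%E -> 0 <= c ->
  (c%:E * (\esum_(i in D) a i) = \esum_(i in D) (c%:E * a i))%E.
Proof.
move=> /esum_countable_series[e _ eE] a0 c0.
rewrite eE// eE; last by move=> i; rewrite mule_ge0.
rewrite -nneseriesZl//; last by move=> n _; case: (e n) => /=.
by apply: eq_eseriesr => n _; case: (e n) => //=; rewrite mule0.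
Qed.

Lemma measure_le_esum (I : choiceType) (D : set I) (A : I -> set T) (B : set T) :
  countable D -> (forall i, D i -> measurable (A i)) -> measurable B ->
  B `<=` \bigcup_(i in D) A i -> (mu B <= \esum_(i in D) mu (A i))%E.
Proof.
move=> /esum_countable_series[e [eD De] eE] mA mB BA; rewrite eE//.
apply: (@le_trans _ _ (\sum_(n <oo) mu (oapp A set0 (e n)))%E).
  apply: measure_sigma_subadditive => //.
    by move=> n; case en : (e n) => [i|] //=; apply: mA; exact: eD en.
  by move=> x /BA[i /De[n en] Ax]; exists n; rewrite ?en.
apply: lee_nneseries => // n _; case: (e n) => //=.
by rewrite measure0.
Qed.

(** A sum over an arbitrary index set is the supremum of its finite subsums, and
    each of those is the measure of a finite disjoint union. *)
Lemma esum_measure_le (I : choiceType) (D : set I) (A : I -> set T) (B : set T) :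
  trivIset D A -> (forall i, D i -> measurable (A i)) -> measurable B ->
  (forall i, D i -> A i `<=` B) -> (\esum_(i in D) mu (A i) <= mu B)%E.
Proof.
move=> tA mA mB AB; apply: ge_ereal_sup => _ [F [finF FD] <-].
rewrite -measure_fin_bigcup//.
- apply: le_measure; rewrite ?inE//.
    by apply: fin_bigcup_measurable => // i /FD; exact: mA.
  by move=> x [i /FD Di Ax]; exact: AB Di _ Ax.
- by apply: sub_trivIset tA.
- by move=> i /FD; exact: mA.
Qed.

Lemma negligible_countable_bigcup (I : choiceType) (D : set I) (A : I -> set T) :
  countable D -> (forall i, D i -> mu.-negligible (A i)) ->
  mu.-negligible (\bigcup_(i in D) A i).
Proof.
move=> /esum_countable_series[e [eD De] _] nA.
apply: (@negligibleS _ _ _ _ (\bigcup_n oapp A set0 (e n))).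
  by move=> x [i /De[n en] Ax]; exists n => //; rewrite en.
apply: negligible_bigcup => n; case en : (e n) => [i|] /=.
  by apply: nA; exact: eD en.
exact: negligible_set0.
Qed.

Lemma measurable_esum (I : choiceType) (D : set I) (f : I -> T -> \bar R) :
  countable D -> (forall i x, 0 <= f i x)%E ->
  (forall i, D i -> measurable_fun setT (f i)) ->
  measurable_fun setT (fun x => \esum_(i in D) f i x).
Proof.
move=> /esum_countable_series[e [eD _] eE] f0 mf.
under eq_fun do rewrite eE//.
apply: ge0_emeasurable_sum => [n x _ _|n _]; first by case: (e n) => /=.
case en : (e n) => [i|] /=; first by apply: mf; exact: eD en.
exact: measurable_cst.
Qed.

Lemma integral_esum (I : choiceType) (D : set I) (f : I -> T -> \bar R) :
  countable D -> (forall i x, 0 <= f i x)%E ->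
  (forall i, D i -> measurable_fun setT (f i)) ->
  (\int[mu]_x (\esum_(i in D) f i x) = \esum_(i in D) \int[mu]_x f i x)%E.
Proof.
move=> /esum_countable_series[e [eD _] eE] f0 mf.
under eq_integral do rewrite eE//.
rewrite integral_nneseries//; last 2 first.
- move=> n; case en : (e n) => [i|] /=; [|exact: measurable_cst].
  by apply: mf; exact: eD en.
- by move=> n x _; case: (e n) => /=.
rewrite eE; last by move=> i; apply: integral_ge0.
apply: eq_eseriesr => n _; case: (e n) => //=.
exact: integral0.
Qed.

End CountableSums.

(** * Sums of sets in a topological abelian group *)

Definition sumset (G : zmodType) (A B : set G) : set G :=
  [set x.1 + x.2 | x in A `*` B].

Fixpoint multset (G : zmodType) (A : set G) (k : nat) : set G :=
  if k is k'.+1 then sumset (multset A k') A else [set 0].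

Section SumsetAlgebra.
Variable G : zmodType.
Implicit Types A B C : set G.

Lemma sumsetP A B z : sumset A B z <-> exists a b, [/\ A a, B b & z = a + b].
Proof.
split=> [[[a b] [/= Aa Bb] <-]|[a [b [Aa Bb ->]]]]; first by exists a, b.
by exists (a, b).
Qed.

Lemma mem_sumset A B a b : A a -> B b -> sumset A B (a + b).
Proof. by move=> Aa Bb; apply/sumsetP; exists a, b. Qed.

Lemma sumsetS A A' B B' : A `<=` A' -> B `<=` B' -> sumset A B `<=` sumset A' B'.
Proof.
move=> AA BB z /sumsetP[a [b [Aa Bb ->]]].
by apply: mem_sumset; [exact: AA|exact: BB].
Qed.

Lemma sumset0l A : sumset [set 0] A = A.
Proof.
apply/seteqP; split=> z; first by move=> /sumsetP[a [b [-> Bb ->]]]; rewrite add0r.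
by move=> Az; rewrite -[z]add0r; exact: mem_sumset.
Qed.

Lemma multset1 A : multset A 1 = A. Proof. exact: sumset0l. Qed.

Lemma multset_subS A k : A 0 -> multset A k `<=` multset A k.+1.
Proof. by move=> A0 z kz; rewrite -[z]addr0; exact: mem_sumset. Qed.

Lemma sub_multset A k : A 0 -> (0 < k)%N -> A `<=` multset A k.
Proof.
move=> A0; case: k => // k _; elim: k => [|k IH]; first by rewrite multset1.
by move=> z /IH; exact: multset_subS.
Qed.

End SumsetAlgebra.

Section TopologicalGroup.
Variable G : topologicalZmodType.
Implicit Types A B C K U V : set G.

Lemma image_addE (a : G) A : (+%R a) @` A = (fun x => x - a) @^-1` A.
Proof.
apply/seteqP; split=> [_ [x Ax <-]|x Ax] /=; first by rewrite addrC addKr.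
by exists (x - a) => //; rewrite addrC subrK.
Qed.

Lemma continuous_subl (a : G) : continuous (fun x : G => x - a).
Proof.
move=> x; apply: (@continuous_comp _ _ _ (fun x => (x, a)) (fun p : G * G => p.1 - p.2)).
  by apply: cvg_pair; [exact: cvg_id|exact: cvg_cst].
exact: sub_continuous.
Qed.

Lemma continuous_subr (a : G) : continuous (fun x : G => a - x).
Proof.
move=> x; apply: (@continuous_comp _ _ _ (fun x => (a, x)) (fun p : G * G => p.1 - p.2)).
  by apply: cvg_pair; [exact: cvg_cst|exact: cvg_id].
exact: sub_continuous.
Qed.

Lemma open_image_add (a : G) U : open U -> open ((+%R a) @` U).
Proof. by rewrite image_addE => oU; apply: open_comp => // x _; exact: continuous_subl. Qed.

Lemma open_sumset A U : open U -> open (sumset A U).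
Proof.
move=> oU.
have -> : sumset A U = \bigcup_(a in A) ((+%R a) @` U).
  apply/seteqP; split=> z.
    by move=> /sumsetP[a [b [Aa Bb ->]]]; exists a => //; exists b.
  by move=> [a Aa [b Bb <-]]; exact: mem_sumset.
by apply: bigcup_open => a _; exact: open_image_add.
Qed.

Lemma compact_sumset K1 K2 : compact K1 -> compact K2 -> compact (sumset K1 K2).
Proof.
move=> c1 c2; apply: continuous_compact; last exact: compact_setX.
by apply: continuous_subspaceT => x; exact: add_continuous.
Qed.

Lemma open_multset U k : open U -> (0 < k)%N -> open (multset U k).
Proof. by case: k => // k oU _; exact: open_sumset. Qed.

Hypothesis hausG : hausdorff_space G.

Lemma precompactP A : precompact A <-> exists2 K, compact K & A `<=` K.
Proof.
split=> [|[K cK AK]]; first by move=> [K AK [cK _]]; exists K.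
by exists K => //; split=> //; exact: compact_closed.
Qed.

Lemma precompact_sumset A B : precompact A -> precompact B -> precompact (sumset A B).
Proof.
move=> /precompactP[K cK AK] /precompactP[L cL BL]; apply/precompactP.
by exists (sumset K L); [exact: compact_sumset|exact: sumsetS].
Qed.

Lemma precompact_multset A k : precompact A -> precompact (multset A k).
Proof.
move=> pA; elim: k => [|k IH] /=; last exact: precompact_sumset.
by apply/precompactP; exists [set 0] => //; exact: compact_set1.
Qed.

Lemma precompactU A B : precompact A -> precompact B -> precompact (A `|` B).
Proof.
move=> /precompactP[K cK AK] /precompactP[L cL BL]; apply/precompactP.
by exists (K `|` L); [exact: compactU|exact: setUSS].
Qed.

(** Compactness is only used through increasing covers: the conclusion is then an
    eventual property of n, hence a case of the near-covering characterization. *)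
Lemma compact_increasing_cover (T : topologicalType) (K : set T)
    (U : nat -> set T) :
  compact K -> (forall n, open (U n)) -> {homo U : m n / (m <= n)%N >-> m `<=` n} ->
  K `<=` \bigcup_n U n -> exists n, K `<=` U n.
Proof.
move=> /compact_near_coveringP cK oU Un KU.
have [n _ nP] : \forall n \near \oo, K `<=` U n.
  apply: cK => x /KU[n _ Unx].
  exists (U n, [set m | (n <= m)%N]).
    split => /=; first by apply: open_nbhs_nbhs; split; [exact: oU|].
    by exists n.
  by move=> [y m] /= [Uy nm]; exact: Un nm _ Uy.
by exists n; exact: nP n (leqnn n).
Qed.

End TopologicalGroup.

Section SecondCountableGroup.
Variable G : topologicalZmodType.
Hypotheses (hausG : hausdorff_space G) (lcG : locally_compact [set: G])
  (scG : @second_countable G).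

Lemma second_countable_basis (T : topologicalType) : @second_countable T ->
  exists2 b : nat -> set T, (forall n, open (b n)) &
    forall x U, nbhs x U -> exists2 n, b n x & b n `<=` U.
Proof.
move=> [B /countable_injP[f finj] [Bo Bb]].
pose b n := xget set0 (B `&` f @^-1` [set n]).
exists b => [n|x U /Bb[V [BV Vx] VU]].
  by rewrite /b; case: xgetP => [A _ [/Bo]|_]//; exact: open0.
suff bV : b (f V) = V by exists (f V); rewrite bV.
rewrite /b; case: xgetP => [A _ [BA /= fA]|/(_ V)[]]//.
by apply: finj => //; exact/mem_set.
Qed.

Lemma dense_sequence : exists2 xi : nat -> G,
  forall U, open U -> U !=set0 -> exists n, U (xi n)
  & forall V, open V -> V 0 -> \bigcup_n ((+%R (xi n)) @` V) = setT.
Proof.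
have [b bo bP] := second_countable_basis scG.
have h U : open U -> U !=set0 -> exists n, U (xget 0 (b n)).
  move=> oU [x Ux]; have [n bx bU] := bP x U (open_nbhs_nbhs (conj oU Ux)).
  exists n; apply: bU; apply: xgetPex; by exists x.
exists (fun n => xget 0 (b n)) => // V oV V0.
apply/seteqP; split=> // x _.
have [||n Vn] := h ((fun y => x - y) @^-1` V).
  by apply: open_comp => // y _; exact: continuous_subr.
  by exists x; rewrite /= subrr.
by exists n => //; eexists; [exact: Vn|rewrite addrC subrK].
Qed.

Definition exhaustion (U : nat -> set G) : Prop :=
  [/\ forall n, open (U n), forall n, precompact (U n), forall n, U n 0,
      {homo U : m n / (m <= n)%N >-> m `<=` n}
    & \bigcup_n U n = setT].

Lemma precompact_nbhs (x : G) : exists U, [/\ open U, precompact U & U x].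
Proof.
have := @lcG x I; rewrite withinET => -[K nK [cK clK]].
exists (interior K); split; [exact: open_interior| |by []].
by exists K => //; exact: interior_subset.
Qed.

(** Add to a fixed neighbourhood of 0 the relatively compact members of a countable
    basis, one after the other. *)
Lemma exhaustion_exists : exists U, exhaustion U.
Proof.
have [b bo bP] := second_countable_basis scG.
have [V [oV pV V0]] := precompact_nbhs 0.
pose W n := if `[< precompact (b n) >] then b n else set0.
have oW n : open (W n) by rewrite /W; case: ifP => // _; exact: open0.
have pW n : precompact (W n).
  rewrite /W; case: ifPn => [/asboolP//|_].
  by apply/(precompactP hausG); exists set0 => //; exact: compact0.
pose U n := V `|` \big[setU/set0]_(i < n) W i.
have Ule : {homo U : m n / (m <= n)%N >-> m `<=` n}.
  by move=> m n mn; apply: setUS; exact: subset_bigsetU.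
exists U; split=> //.
- move=> n; apply: openU => //; rewrite -bigcup_mkord.
  by apply: bigcup_open => i _.
- move=> n; apply: precompactU => //.
  elim: n => [|n IH].
    rewrite big_ord0; apply/(precompactP hausG).
    by exists set0 => //; exact: compact0.
  by rewrite big_ord_recr; exact: precompactU.
- by move=> n; left.
- apply/seteqP; split=> // x _.
  have [Q [oQ pQ Qx]] := precompact_nbhs x.
  have [n bx bQ] := bP x Q (open_nbhs_nbhs (conj oQ Qx)).
  exists n.+1 => //; right; rewrite big_ord_recr /=; right.
  rewrite /W; case: ifPn => // /asboolP[]; exact: precompact_subset pQ.
Qed.

Lemma exhaustion_absorbs (U : nat -> set G) (A : set G) :
  exhaustion U -> precompact A -> exists n, A `<=` U n.
Proof.
move=> [oU pU U0 Ule UT] /(precompactP hausG)[K cK AK].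
have [|n KU] := compact_increasing_cover cK oU Ule; first by rewrite UT.
by exists n => z /AK; exact: KU.
Qed.

End SecondCountableGroup.

(** * Borel sets and Haar measure *)

Section BorelMeasurability.
Context {R : realType} {X : topologicalZmodType}.

Lemma borel_open (U : set X) : open U -> measurable (U : set (borel X)).
Proof. by move=> oU; exact: sub_sigma_algebra. Qed.

Lemma borel_closed (A : set X) : closed A -> measurable (A : set (borel X)).
Proof.
by move=> cA; rewrite -[A]setCK; apply: measurableC; apply: borel_open; exact: closed_openC.
Qed.

Lemma borel_compact (K : set X) :
  hausdorff_space X -> compact K -> measurable (K : set (borel X)).
Proof. by move=> hX cK; apply: borel_closed; exact: compact_closed. Qed.

Lemma measurable_continuous_real (f : X -> R) :
  continuous f -> measurable_fun setT (f : borel X -> R).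
Proof.
move=> cf _; apply: (measurability _ (RGenOInfty.measurableE R)) => //.
move=> _ [_ [a ->] <-]; rewrite setTI; apply: borel_open.
by apply: open_comp => [x _|]; [exact: cf|exact: interval_open].
Qed.

Lemma measurable_continuous_borel (f : X -> X) :
  continuous f -> measurable_fun setT (f : borel X -> borel X).
Proof.
move=> cf.
apply: (@measurability _ _ (borel X) (borel X) _ _ [set U : set X | open U]) => //.
move=> _ [U oU <-].
rewrite setTI; apply: borel_open.
by apply: open_comp => // x _; exact: cf.
Qed.

Lemma measurable_subl (a : X) :
  measurable_fun setT ((fun x => x - a) : borel X -> borel X).
Proof. by apply: measurable_continuous_borel; exact: continuous_subl. Qed.

Lemma measurable_image_add (a : X) (A : set X) :
  measurable (A : set (borel X)) -> measurable ((+%R a) @` A : set (borel X)).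
Proof.
rewrite image_addE => mA; rewrite -[X in measurable X]setTI.
exact: measurable_subl.
Qed.

End BorelMeasurability.

Lemma measure_bigcup_fin {d} {T : measurableType d} {R : realType}
    (mu : {measure set T -> \bar R}) (I : finType) (A : I -> set T) :
  (forall i, measurable (A i)) ->
  (mu (\bigcup_i A i) <= \sum_(i : I) mu (A i))%E.
Proof.
move=> mA.
have -> : \bigcup_i A i = \big[setU/set0]_(i <- enum I) A i.
  rewrite -bigcup_seq (_ : [set` enum I] = setT)//; apply/seteqP; split=> i //= _.
  by rewrite mem_enum.
rewrite -[leRHS]big_enum /=; elim: (enum I) => [|i s IH].
  by rewrite !big_nil measure0.
rewrite !big_cons; apply: le_trans (leeD2l _ IH).
apply: measureU2 => //; elim: s {IH} => [|j s IH]; first by rewrite big_nil.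
by rewrite big_cons; exact: measurableU.
Qed.

(** The exponential series dominates each of its terms; the one of degree r + 1
    already beats the polynomial. *)
Lemma poly_lt_geometric (R : realType) (eps : R) (r : nat) : 0 < eps ->
  exists k, (k.+1%:R ^+ r < (1 + eps) ^+ k :> R).
Proof.
move=> e0.
have l0 : 0 < ln (1 + eps) by rewrite ln_gt0// ltrDl.
set c := ln (1 + eps) in l0.
have [k kP] : exists k : nat, 2 ^+ r * r.+1`!%:R / c ^+ r.+1 < k%:R :> R.
  exists (Num.truncn (2 ^+ r * r.+1`!%:R / c ^+ r.+1)).+1.
  by rewrite -truncn_le_nat ?ltnS.
have k0 : (0 < k)%N.
  rewrite -(ltr0n R); apply: le_lt_trans kP.
  by rewrite !mulr_ge0 ?invr_ge0 ?exprn_ge0// ltW.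
exists k.
have -> : (1 + eps) ^+ k = expR (k%:R * c).
  by rewrite expRM_natl /c lnK// posrE addr_gt0.
have kc0 : 0 <= k%:R * c by rewrite mulr_ge0 // ltW.
apply: lt_le_trans (expR_ge1Dxn r kc0).
apply: (@lt_le_trans _ _ ((k%:R * c) ^+ r.+1 / r.+1`!%:R)); last by rewrite lerDr.
apply: (@le_lt_trans _ _ (2 ^+ r * k%:R ^+ r)).
  rewrite -exprMn lerXn2r ?nnegrE ?mulr_ge0// -natrM ler_nat.
  by rewrite mul2n -addnn -addn1 leq_add2l.
move: kP; rewrite ltr_pdivrMr ?exprn_gt0// => kP.
rewrite exprMn [k%:R ^+ r.+1]exprS ltr_pdivlMr ?ltr0n ?fact_gt0//.
have q0 : 0 < k%:R ^+ r :> R by rewrite exprn_gt0// ltr0n.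
rewrite [k%:R * k%:R ^+ r]mulrC.
by rewrite -[ltLHS]mulrA [ltLHS]mulrCA -[ltRHS]mulrA ltr_pM2l.
Qed.

Section Haar.
Context {R : realType} {G : topologicalZmodType}.
Hypotheses (hausG : hausdorff_space G) (scG : @second_countable G).
Variable mu : {measure set (borel G) -> \bar R}.
Hypothesis haar_mu : haar_measure mu.

Lemma haar_image_add (a : G) (A : set G) :
  measurable (A : set (borel G)) -> mu ((+%R a) @` A) = mu A.
Proof. by case: haar_mu => + _ _; exact. Qed.

Lemma haar_precompact_lty (A : set G) :
  measurable (A : set (borel G)) -> precompact A -> (mu A < +oo)%E.
Proof.
move=> mA /(precompactP hausG)[K cK AK]; case: haar_mu => _ /(_ K cK) Koo _.
apply: le_lt_trans Koo; apply: le_measure => //; rewrite inE//.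
exact: borel_compact.
Qed.

Lemma haar_precompact_fin (A : set G) :
  measurable (A : set (borel G)) -> precompact A -> mu A \is a fin_num.
Proof. by move=> mA pA; rewrite ge0_fin_numE//; exact: haar_precompact_lty. Qed.

Lemma haar_nbhs0_gt0 (U : set G) : open U -> U 0 -> (0 < mu U)%E.
Proof. by case: haar_mu => _ _ h oU U0; apply: h => //; exists 0. Qed.

Lemma measurable_multset (U : set G) k : open U -> (0 < k)%N ->
  measurable (multset U k : set (borel G)).
Proof. by move=> oU k0; apply: borel_open; exact: open_multset. Qed.

(** If U + U is covered by r translates of U, then by induction the k-fold sum of U
    is covered by its translates by the integral combinations of the r translation
    vectors with coefficients below k; commutativity is what makes the number of
    these combinations polynomial. *)
Lemma multset_growth (U : set G) : open U -> precompact U -> U 0 ->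
  exists r, forall k, (mu (multset U k.+1) <= (k.+1%:R ^+ r)%:E * mu U)%E.
Proof.
move=> oU pU U0.
have [xi _ xiP] := dense_sequence scG.
have /(precompactP hausG)[K cK UK] := precompact_sumset hausG pU pU.
pose V n := \bigcup_(i in [set i | (i < n)%N]) ((+%R (xi i)) @` U).
have [r KV] : exists r, K `<=` V r.
  apply: compact_increasing_cover cK _ _ _.
  - by move=> n; apply: bigcup_open => i _; exact: open_image_add.
  - by move=> m n mn x [i /= im Ux]; exists i => //=; exact: leq_trans mn.
  - move=> x _; have : (\bigcup_n ((+%R (xi n)) @` U)) x by rewrite xiP.
    by move=> [i _ Ux]; exists i.+1 => //; exists i => //=.
exists r => k.
pose s (c : 'I_r -> nat) := \sum_(i < r) xi i *+ c i.
have cover j : multset U j.+1 `<=`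
    [set z | exists c, (forall i, (c i <= j)%N) /\ ((+%R (s c)) @` U) z].
  elim: j => [z|j IH z /=].
    rewrite multset1 => Uz; exists (fun=> 0%N); split=> //; exists z => //.
    by rewrite /s big1 ?add0r// => i _; rewrite mulr0n.
  move=> /sumsetP[y [u [/IH[c [cj [v Uv <-]]] Uu ->]]].
  have /UK/KV[i /= ir [w Uw wE]] : sumset U U (v + u) by exact: mem_sumset.
  pose i' := Ordinal ir.
  exists (fun l => (c l + (l == i'))%N); split.
    move=> l; rewrite -[j.+1]addn1; apply: leq_add (cj l) _.
    by case: (l == i').
  exists w => //; rewrite -addrA -wE addrA; congr (_ + _).
  rewrite /s; under eq_bigr do rewrite mulrnDr; rewrite big_split /=; congr (_ + _).
  by rewrite (bigD1 i')//= eqxx mulr1n big1 ?addr0// => l /negPf ->.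
pose A (c : {ffun 'I_r -> 'I_k.+1}) := (+%R (s (fun i => c i))) @` U.
have mA c : measurable (A c : set (borel G)).
  by apply: borel_open; exact: open_image_add.
apply: (@le_trans _ _ (mu (\bigcup_c A c))).
  apply: le_measure; rewrite ?inE; [exact: measurable_multset| |].
    by apply: fin_bigcup_measurable => // c _.
  move=> z /cover[c [ck Uz]]; exists [ffun i => inord (c i)] => //.
  rewrite /A (_ : s _ = s c)//; apply: eq_bigr => i _.
  by rewrite ffunE inordK // ltnS.
apply: (le_trans (measure_bigcup_fin mu mA)).
rewrite (eq_bigr (fun=> mu U)); last first.
  by move=> c _; have := @haar_image_add (s (fun i => c i)) U (borel_open oU).
have /fineK <- : mu U \is a fin_num.
  by apply: haar_precompact_fin => //; exact: borel_open.
by rewrite sumEFin sumr_const card_ffun !card_ord -EFinM -natrX mulr_natl.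
Qed.

(** Otherwise mu (kU) would grow at least like (1 + eps)^k, against the polynomial
    bound. *)
Lemma multset_folner (U : set G) (eps : R) : 0 < eps ->
  open U -> precompact U -> U 0 ->
  exists2 k, (0 < k)%N & (mu (multset U k.+1) <= (1 + eps)%:E * mu (multset U k))%E.
Proof.
move=> e0 oU pU U0; apply: contrapT => /forall2NP noF.
have [r growth] := multset_growth oU pU U0.
have low k : (((1 + eps) ^+ k)%:E * mu U <= mu (multset U k.+1))%E.
  elim: k => [|k IH]; first by rewrite expr0 mul1e multset1.
  have [//|/negP] := noF k.+1; rewrite -ltNge => /ltW; apply: le_trans.
  rewrite exprS EFinM -muleA; rewrite lee_pmul2l//.
  by rewrite lte_fin addr_gt0.
have [k] := poly_lt_geometric r e0.
apply/negP; rewrite -leNgt -lee_fin.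
have Ufin : mu U \is a fin_num by apply: haar_precompact_fin => //; exact: borel_open.
rewrite -(@lee_pmul2r _ (mu U))//; last exact: haar_nbhs0_gt0.
exact: le_trans (low k) (growth k).
Qed.

Section Folner.
Variable U : nat -> set G.
Hypothesis exU : exhaustion U.

Lemma folner_index : exists k : nat -> nat, forall n, (0 < k n)%N /\
  (mu (multset (U n) (k n).+1) <= (1 + n.+1%:R^-1)%:E * mu (multset (U n) (k n)))%E.
Proof.
have [oU pU U0 _ _] := exU.
suff /choice[k kP] : forall n, exists k, (0 < k)%N /\
  (mu (multset (U n) k.+1) <= (1 + n.+1%:R^-1)%:E * mu (multset (U n) k))%E.
  by exists k.
move=> n; have [|k k0 kP] := @multset_folner (U n) n.+1%:R^-1 _ (oU n) (pU n) (U0 n).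
  by rewrite invr_gt0.
by exists k.
Qed.

(** A translate of kU by a point of U stays in (k+1)U, so the index chosen for U n
    makes the relative boundary at most 1/(n+1) once x lies in U n. *)
Lemma multset_averaging (k : nat -> nat) :
  (forall n, (0 < k n)%N /\
    (mu (multset (U n) (k n).+1) <= (1 + n.+1%:R^-1)%:E * mu (multset (U n) (k n)))%E) ->
  averaging_sequence mu (fun n => multset (U n) (k n)).
Proof.
move=> kP; have [oU pU U0 Ule UT] := exU.
pose H n := multset (U n) (k n).
have k0 n : (0 < k n)%N by case: (kP n).
have mH n : measurable (H n : set (borel G)) by exact: measurable_multset.
have mHS n : measurable (multset (U n) (k n).+1 : set (borel G)).
  exact: measurable_multset.
have Hfin n : mu (H n) \is a fin_num.
  by apply: haar_precompact_fin => //; exact: precompact_multset.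
have HSfin n : mu (multset (U n) (k n).+1) \is a fin_num.
  by apply: haar_precompact_fin => //; exact: precompact_multset.
have UH n : U n `<=` H n by exact: sub_multset.
have Hgt0 n : 0 < fine (mu (H n)).
  apply: fine_gt0; rewrite ltey_eq Hfin andbT.
  by apply: haar_nbhs0_gt0; [exact: open_multset|apply: UH].
split.
- move=> n; split; [exact: open_multset|exact: precompact_multset|].
  by exists 0; exact: UH.
- apply/seteqP; split=> // x _.
  have [n _ Ux] : (\bigcup_n U n) x by rewrite UT.
  by exists n => //; exact: UH.
move=> x.
have [N _ NUx] : (\bigcup_n U n) x by rewrite UT.
apply: (@squeeze_cvgr _ _ _ _ (cst 0) (fun n => n.+1%:R^-1)); last 2 first.
- exact: cvg_cst.
- exact: cvg_harmonic.
near=> n; apply/andP; split; first by rewrite divr_ge0 ?fine_ge0.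
rewrite ler_pdivrMr; last exact: Hgt0.
have mD : measurable (((+%R x) @` H n) `&` ~` H n : set (borel G)).
  by apply: measurableI; [exact: measurable_image_add|exact: measurableC].
have DS : ((+%R x) @` H n) `&` ~` H n `<=` multset (U n) (k n).+1 `\` H n.
  move=> z [[y Hy <-] nH]; split=> //; rewrite addrC; apply: mem_sumset => //.
  by apply: Ule NUx; near: n; exists N.
have HS : H n `<=` multset (U n) (k n).+1 by exact: multset_subS.
rewrite -lee_fin EFinM fineK; last first.
  rewrite ge0_fin_numE//; apply: (@le_lt_trans _ _ (mu (H n))); last first.
    by rewrite ltey_eq Hfin.
  rewrite -(haar_image_add x (mH n)); apply: le_measure; rewrite ?inE//.
  exact: measurable_image_add.
apply: (@le_trans _ _ (mu (multset (U n) (k n).+1 `\` H n))).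
  by apply: le_measure; rewrite ?inE//; exact: measurableD.
rewrite measureD//; last by rewrite ltey_eq HSfin.
rewrite setIidr// leeBlDr; last exact: Hfin.
rewrite (fineK (Hfin n)) -[X in (_ + X)%E]mul1e -ge0_muleDl ?lee_fin ?invr_ge0//.
by rewrite -EFinD addrC; case: (kP n).
Unshelve. all: by end_near. Qed.

End Folner.

End Haar.

Section HaarIntegral.
Context {R : realType} {G : topologicalZmodType}.
Variable mu : {measure set (borel G) -> \bar R}.
Hypothesis haar_mu : haar_measure mu.

(** The push-forward of a Haar measure by a translation is the measure itself. *)
Lemma ge0_integral_translate (f : borel G -> \bar R) (a : G) :
  measurable_fun setT f -> (forall x, 0 <= f x)%E ->
  (\int[mu]_x f (x - a)%R = \int[mu]_x f x)%E.
Proof.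
move=> mf f0.
have mphi := measurable_subl a.
have := @ge0_integral_pushforward _ _ _ _ R _ mphi mu setT f measurableT mf
  (fun y _ => f0 y).
rewrite preimage_setT => <-.
apply: (eq_measure_integral mu) => A mA _.
by have := haar_image_add haar_mu a mA; rewrite image_addE.
Qed.

End HaarIntegral.

(** * Lattices *)

Section LatticeTiling.
Context {R : realType} {G : topologicalZmodType}.
Hypotheses (hausG : hausdorff_space G) (lcG : locally_compact [set: G])
  (scG : @second_countable G).
Variable mu : {measure set (borel G) -> \bar R}.
Hypothesis haar_mu : haar_measure mu.
Variable Gamma : zmodClosed G.

(** Packing and covering are meant pointwise, not up to null sets, so that counting
    lattice points through a tile is exact. *)
Definition packing (P : set G) : Prop :=
  forall x y, P x -> P y -> x - y \in Gamma -> x = y.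

Definition covering (P : set G) : Prop :=
  forall x, exists2 gamma, gamma \in Gamma & P (x - gamma).

Hypothesis latticeGamma : lattice Gamma.

(** Discreteness at 0, transported by the continuity of subtraction. *)
Lemma lattice_separating :
  exists V, [/\ open V, precompact V, V 0 & packing V].
Proof.
have [disc _] := latticeGamma.
have G0 : (0 : G) \in [set` Gamma] by rewrite inE /= rpred0.
have [W oW WE] := disc (SigSub G0).
have W0 : W 0.
  have : (set_val @^-1` W : set (set_type [set` Gamma])) (SigSub G0) by rewrite WE.
  by [].
have sep g : g \in Gamma -> W g -> g = 0.
  move=> Gg Wg.
  have Gg' : g \in [set` Gamma] by rewrite inE.
  have : (set_val @^-1` W : set (set_type [set` Gamma])) (SigSub Gg') by [].
  by rewrite WE => /(congr1 val).
have : nbhs ((0, 0) : G * G) ((fun p : G * G => p.1 - p.2) @^-1` W).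
  apply: sub_continuous; rewrite /= subr0.
  by apply: open_nbhs_nbhs.
move=> [[V1 V2] [/= n1 n2] V12].
have [Q [oQ pQ Q0]] := precompact_nbhs lcG 0.
exists (interior V1 `&` interior V2 `&` Q); split.
- by apply: openI => //; apply: openI; exact: open_interior.
- by apply: precompact_subset pQ => x [].
- by [].
move=> x y [[Vx _] _] [[_ Vy] _] xy; apply/eqP; rewrite -subr_eq0; apply/eqP.
apply: sep => //; apply: (V12 (x, y)); split => /=; exact: interior_subset.
Qed.

(** The translates of a packing neighbourhood are disjoint, so a dense sequence
    visits each of them at a different index. *)
Lemma lattice_countable : countable [set` Gamma].
Proof.
have [V [oV _ V0 sepV]] := lattice_separating.
have [xi xiP _] := dense_sequence scG.
have /choice[f fP] (gamma : G) : exists n, ((+%R gamma) @` V) (xi n).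
  by apply: xiP; [exact: open_image_add|exists gamma; exists 0 => //; rewrite addr0].
apply/countable_injP; exists f => g g' /set_mem Gg /set_mem Gg' fgg'.
have [v Vv vE] := fP g; have [v' Vv' v'E] := fP g'.
have e : g + v = g' + v' by rewrite vE v'E fgg'.
have d : v - v' = g' - g.
  by rewrite -[v](addKr g) e -!addrA subrr addr0 addrC.
have vv : v = v' by apply: sepV => //; rewrite d rpredB.
by move: e; rewrite vv => /addIr.
Qed.

(** The images of the members of an exhaustion form an increasing open cover of the
    compact quotient, hence one of them is the whole quotient. *)
Lemma lattice_cocompact (U : nat -> set G) : exhaustion U -> exists n, covering (U n).
Proof.
move=> [oU _ _ Ule UT]; have [_ cQ] := latticeGamma.
pose Q := quotient_topology (Quotient.quot Gamma).
pose W n : set Q := [set q | exists2 x, U n x & \pi_Q%qT x = q].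
have piE x y : (\pi_Q%qT x = \pi_Q%qT y) <-> x - y \in Gamma.
  rewrite Quotient.idealrBE; split=> [h|/eqP h]; last exact: h.
  by apply/eqP; exact: h.
have [n Wn] : exists n, [set: Q] `<=` W n.
  apply: compact_increasing_cover cQ _ _ _.
  - move=> n; rewrite /open /= /quotient_open.
    have -> : \pi_Q%qT @^-1` W n = sumset [set` Gamma] (U n).
      apply/seteqP; split=> x.
        move=> [y Uy /piE yx]; rewrite -[x](subrK y); apply: mem_sumset => //=.
        by rewrite -opprB rpredN.
      move=> /sumsetP[g [u [/= Gg Uu ->]]]; exists u => //; apply/piE.
      by rewrite opprD addrCA subrr addr0 rpredN.
    exact: open_sumset.
  - by move=> m n mn q [x Ux <-]; exists x => //; exact: Ule Ux.
  - move=> q _; have [n _ Un] : (\bigcup_n U n) (repr q) by rewrite UT.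
    by exists n => //; exists (repr q) => //; exact: reprK.
exists n => x; have [y Uy /piE yx] := Wn (\pi_Q%qT x) I.
exists (x - y); first by rewrite -opprB rpredN.
by rewrite opprB addrCA subrr addr0.
Qed.

(** Finitely many small translates P i meet every coset. Removing from each P i
    whatever is equivalent to a point of an earlier one leaves exactly one
    representative of every coset, in the first P i that the coset meets. *)
Lemma lattice_tile : exists D : set G,
  [/\ measurable (D : set (borel G)), precompact D, packing D & covering D].
Proof.
have [V [oV pV V0 sepV]] := lattice_separating.
have [U exU] := exhaustion_exists hausG lcG scG.
have [n covU] := lattice_cocompact exU.
have [xi _ xiP] := dense_sequence scG.
pose P i := (+%R (xi i)) @` V.
have oP i : open (P i) by exact: open_image_add.
pose S i := \bigcup_(l in [set l | (l < i)%N]) P l.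
have oS i : open (S i) by apply: bigcup_open => l _.
have [r US] : exists r, U n `<=` S r.
  have [_ pU _ _ _] := exU; have /(precompactP hausG)[K cK UK] := pU n.
  have [m m' mm x [l /= lm Px]|x _|r KS] := compact_increasing_cover cK oS.
  - by exists l => //=; exact: leq_trans mm.
  - have [i _ Px] : (\bigcup_i P i) x by rewrite xiP.
    by exists i.+1 => //; exists i => /=.
  - by exists r => x /UK /KS.
pose D i := P i `\` sumset [set` Gamma] (S i).
have mD i : measurable (D i : set (borel G)).
  by apply: measurableD; apply: borel_open => //; exact: open_sumset.
exists (\bigcup_(i in [set i | (i < r)%N]) D i); split.
- by apply: bigcup_measurable => i _.
- apply: (@precompact_subset _ _ (S r)).
    by move=> x [i /= ir [Px _]]; exists i.
  rewrite /S; elim: r {US} => [|r IH].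
    by apply/(precompactP hausG); exists set0 => [|x []//]; exact: compact0.
  apply: (@precompact_subset _ _ (S r `|` sumset [set xi r] V)).
    move=> x [l /=]; rewrite ltnS leq_eqVlt => /orP[/eqP-> [v Vv <-]|lr Px].
      by right; exact: mem_sumset.
    by left; exists l.
  apply: precompactU => //; apply: precompact_sumset => //.
  by apply/(precompactP hausG); exists [set xi r] => //; exact: compact_set1.
- have lt_false i j x y : (i < j)%N -> D i x -> D j y -> x - y \in Gamma -> False.
    move=> ij [Px _] [_ nSy] xy; apply: nSy; rewrite -[y](subrK x).
    apply: mem_sumset => /=; first by rewrite -opprB rpredN.
    by exists i.
  move=> x y [i /= ir Dx] [j /= jr Dy] xy.
  case: (ltngtP i j) => [ij|ji|ij]; first by case: (lt_false i j x y).
    by case: (lt_false j i y x) => //; rewrite -opprB rpredN.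
  move: Dx Dy => [[v Vv vx] _]; rewrite -ij => -[[w Vw wy] _].
  rewrite -vx -wy; congr (_ + _); apply: sepV => //.
  by move: xy; rewrite -vx -wy opprD addrACA subrr add0r.
- move=> x.
  have ex : exists i, `[< exists2 g, g \in Gamma & P i (x - g) >].
    have [g Gg /US[i _ Pi]] := covU x; by exists i; apply/asboolP; exists g.
  case: (ex_minnP ex) => i /asboolP[g Gg Pxg] imin.
  exists g => //; exists i; last split=> //.
    have [h Gh /US[j /= jr Pj]] := covU x.
    apply: leq_ltn_trans jr; apply: imin; apply/asboolP; by exists h.
  move=> /sumsetP[h [s [/= Gh [l /= li Ps] e]]].
  suff : (i <= l)%N by rewrite leqNgt li.
  apply: imin; apply/asboolP; exists (g + h); first exact: rpredD.
  by rewrite opprD addrA e addrAC subrr add0r.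
Qed.

Lemma trivIset_packing (P : set G) :
  packing P -> trivIset [set` Gamma] (fun gamma => (+%R gamma) @` P).
Proof.
move=> pP g h /= Gg Gh [x [[p Pp px] [q Pq qx]]].
have e : p - q = h - g.
  by rewrite -[p](addKr g) px -qx -!addrA addrN addr0 addrC.
have pq : p = q by apply: pP => //; rewrite e rpredB.
by move: e; rewrite pq subrr => /esym/eqP; rewrite subr_eq0 => /eqP.
Qed.

(** Cut the packing set along the translates of the covering one and move all the
    pieces into the latter, where they remain disjoint. *)
Lemma packing_le_covering (P D : set G) :
  measurable (P : set (borel G)) -> measurable (D : set (borel G)) ->
  packing P -> covering D -> (mu P <= mu D)%E.
Proof.
move=> mP mD pP cD.
have mPD g : measurable (P `&` (+%R g) @` D : set (borel G)).
  by apply: measurableI => //; exact: measurable_image_add.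
have mPD' g : measurable ((+%R (- g)) @` P `&` D : set (borel G)).
  by apply: measurableI => //; exact: measurable_image_add.
apply: (@le_trans _ _ (\esum_(g in [set` Gamma]) mu (P `&` (+%R g) @` D))).
  apply: measure_le_esum => //; first exact: lattice_countable.
  move=> x Px; have [g Gg Dg] := cD x; exists g => //; split=> //.
  by exists (x - g) => //; rewrite addrC subrK.
rewrite (@eq_esum _ _ _ _ (fun g => mu ((+%R (- g)) @` P `&` D))); last first.
  move=> g _; rewrite -(haar_image_add haar_mu (- g))//; congr (mu _).
  apply/seteqP; split=> x.
    move=> [y [Py [d Dd dy]] <-]; split; first by exists y.
    by rewrite -dy addKr.
  move=> [[p Pp px] Dx]; exists p => //; split=> //; exists x => //.
  by rewrite -px addrA subrr add0r.
apply: esum_measure_le => // g h Gg Gh.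
move=> [x [[[p Pp px] _] [[q Pq qx] _]]].
have e : p - q = g - h.
  by rewrite -[p](addKr (- g)) px -qx opprK -!addrA subrr addr0.
have pq : p = q by apply: pP => //; rewrite e rpredB.
by move: e; rewrite pq subrr => /esym/eqP; rewrite subr_eq0 => /eqP.
Qed.

(** Removing from D0 its null overlaps with its own translates makes it a packing set
    of the same measure. *)
Lemma fundamental_domain_le_covering (D0 D : set G) :
  fundamental_domain mu Gamma D0 -> measurable (D : set (borel G)) ->
  covering D -> (mu D0 <= mu D)%E.
Proof.
move=> [mD0 _ ovl] mD cD.
pose N : set (borel G) :=
  \bigcup_(g in [set g | g \in Gamma /\ g != 0]) (D0 `&` (+%R g) @` D0).
have mI g : measurable (D0 `&` (+%R g) @` D0 : set (borel G)).
  by apply: measurableI => //; exact: measurable_image_add.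
have cN : countable [set g | g \in Gamma /\ g != 0].
  by apply: sub_countable lattice_countable; apply: subset_card_le => g [].
have [M [mM M0 NM]] : mu.-negligible N.
  apply: negligible_countable_bigcup => // g [Gg g0].
  have := ovl 0 g (rpred0 _) Gg; rewrite eq_sym => /(_ g0).
  rewrite (_ : (+%R 0) @` D0 = D0)//.
  by under eq_imagel do rewrite add0r; rewrite image_id.
apply: (@le_trans _ _ (mu (D0 `\` M))); last first.
  apply: packing_le_covering => //; first exact: measurableD.
  move=> x y [Dx nMx] [Dy _] Gxy; apply: contrapT => /eqP xy; apply: nMx; apply: NM.
  exists (x - y); first by rewrite /= subr_eq0.
  by split=> //; exists y => //; rewrite subrK.
have DM0 : mu (D0 `&` M) = 0%E.
  apply/eqP; rewrite -measure_le0 -M0; apply: le_measure; rewrite ?inE//.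
  exact: measurableI.
by rewrite (measureDI mu mD0 mM) [X in (_ + X)%E]DM0 adde0.
Qed.

(** Countably many null translates cannot exhaust G up to a null set. *)
Lemma fundamental_domain_gt0 (D0 : set G) :
  fundamental_domain mu Gamma D0 -> (0 < mu D0)%E.
Proof.
move=> [mD0 cov _]; rewrite lt0e measure_ge0 andbT; apply/eqP => D00.
have [_ _ pos] := haar_mu.
have : mu setT = 0%E.
  apply/(negligibleP mu measurableT).
  rewrite -(setvU (\bigcup_(g in [set` Gamma]) ((+%R g) @` D0))).
  apply: negligibleU => //.
  apply: negligible_countable_bigcup; first exact: lattice_countable.
  move=> g _; apply/(negligibleP mu (measurable_image_add g mD0)).
  exact: etrans (haar_image_add haar_mu g mD0) D00.
by apply/eqP; rewrite gt_eqF//; apply: pos; [exact: openT|exists 0].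
Qed.

(** The tile shows that a fundamental domain exists, so that the covolume is a
    genuine one, and bounds it from above; averages are estimated with the tile,
    which is relatively compact, whereas the chosen fundamental domain may not be. *)
Lemma covol_bounds : exists D : set G,
  [/\ measurable (D : set (borel G)), precompact D, packing D, 0 < covol mu Gamma
    & ((covol mu Gamma)%:E <= mu D)%E].
Proof.
have [D [mD pD packD covD]] := lattice_tile.
have fdD : fundamental_domain mu Gamma D.
  split=> //.
    rewrite (_ : ~` _ = set0); first exact: negligible_set0.
    apply/seteqP; split=> // x; apply; have [g Gg Dg] := covD x.
    by exists g => //; exists (x - g) => //; rewrite addrC subrK.
  move=> g h Gg Gh gh; rewrite (_ : _ `&` _ = set0); first exact: negligible_set0.
  apply/seteqP; split=> // x Ix; move: gh => /eqP; apply.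
  by apply: (trivIset_packing packD) => //; exists x.
have fd0 : fundamental_domain mu Gamma (xget set0 (fundamental_domain mu Gamma)).
  by apply: xgetPex; exists D.
have Dle := fundamental_domain_le_covering fd0 mD covD.
have Dlt : (mu (xget set0 (fundamental_domain mu Gamma)) < +oo)%E.
  exact: le_lt_trans Dle (haar_precompact_lty hausG haar_mu mD pD).
exists D; split=> //.
  by apply: fine_gt0; rewrite fundamental_domain_gt0.
by rewrite /covol fineK// ge0_fin_numE.
Qed.

(** Unfolding: averaging the periodization of phi over H amounts to integrating
    phi against the number of lattice points in the translates of H, and a tile
    inside U bounds that number by a volume comparison between H and H + U. *)
Lemma periodized_average (D U : set G) (k : nat) (phi : G -> R) :
  measurable (D : set (borel G)) -> precompact D -> packing D -> D `<=` U ->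
  open U -> (0 < k)%N ->
  measurable_fun setT (phi : borel G -> R) -> (forall x, 0 <= phi x) ->
  (mu D * \int[mu]_(x in (multset U k : set (borel G)))
            (\esum_(g in [set` Gamma]) (phi (x - g))%:E) <=
   mu (multset U k.+1) * \int[mu]_x (phi x)%:E)%E.
Proof.
move=> mD pD packD DU oU k0 mphi phi0.
have cG := lattice_countable.
set H := multset U k.
have mH : measurable (H : set (borel G)) by exact: measurable_multset.
have Dfin := haar_precompact_fin hausG haar_mu mD pD.
have mphit g : measurable_fun setT (fun x : borel G => (phi (x - g))%:E).
  apply/measurable_EFinP.
  exact: (measurableT_comp mphi (measurable_subl g)).
have mindic g : measurable_fun setT (fun x : borel G => (\1_H (x + g) : R)).
  rewrite -[g]opprK.
  exact: (measurableT_comp (measurable_indic mH) (measurable_subl (- g))).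
rewrite integral_mkcond.
rewrite [X in (_ * X <= _)%E](_ : _ =
    \int[mu]_x (\esum_(g in [set` Gamma]) (phi (x - g) * \1_H x)%:E))%E; last first.
  apply: eq_integral => x _; rewrite patchE; case: ifPn => Hx; last first.
    by rewrite esum1// => g _; rewrite indicE (negbTE Hx) mulr0.
  by apply: eq_esum => g _; rewrite indicE Hx mulr1.
rewrite integral_esum//; last 2 first.
- by move=> g x; rewrite lee_fin mulr_ge0.
- move=> g _; apply/measurable_EFinP; apply: measurable_funM.
    by apply/measurable_EFinP; exact: mphit.
  exact: measurable_indic.
rewrite (eq_esum (b := fun g => \int[mu]_x (phi x * \1_H (x + g))%:E)%E); last first.
  move=> g _.
  rewrite -(ge0_integral_translate haar_mu
              (f := fun x => (phi x * \1_H (x + g))%:E) g).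
  - by apply: eq_integral => x _; rewrite subrK.
  - by apply/measurable_EFinP; apply: measurable_funM.
  - by move=> x; rewrite lee_fin mulr_ge0.
rewrite -integral_esum//; last 2 first.
- by move=> g x; rewrite lee_fin mulr_ge0.
- by move=> g _; apply/measurable_EFinP; apply: measurable_funM.
have mS : measurable_fun setT
   (fun x : borel G => \esum_(g in [set` Gamma]) (phi x * \1_H (x + g))%:E).
  apply: measurable_esum => // [g x|g _]; first by rewrite lee_fin mulr_ge0.
  by apply/measurable_EFinP; apply: measurable_funM.
have mphiE : measurable_fun setT (fun x : borel G => (phi x)%:E).
  exact/measurable_EFinP.
rewrite -ge0_integralZl//; last first.
  by move=> x _; apply: esum_ge0 => g _; rewrite lee_fin mulr_ge0.
rewrite -ge0_integralZl//; last by move=> x _; rewrite lee_fin.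
apply: ge0_le_integral => //.
- move=> x _; apply: mule_ge0 => //.
  by apply: esum_ge0 => g _; rewrite lee_fin mulr_ge0.
- by apply: measurable_funeM.
- by apply: measurable_funeM; exact/measurable_EFinP.
move=> x _; rewrite [leRHS]muleC.
rewrite (eq_esum (b := fun g => ((phi x)%:E * (\1_H (x + g))%:E)%E)); last first.
  by move=> g _; rewrite EFinM.
rewrite -esum_countableZl// muleCA; apply: lee_wpmul2l; first by rewrite lee_fin.
rewrite -(fineK Dfin) esum_countableZl ?fine_ge0//.
rewrite (eq_esum (b := fun g => ((\1_H (x + g) : R)%:E * mu D)%E)); last first.
  by move=> g _; rewrite fineK// muleC.
rewrite [leLHS](_ : _ =
  \esum_(g in [set g | g \in Gamma /\ H (x + g)]) mu ((+%R (x + g)) @` D)); last first.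
  rewrite [LHS]esum_mkcond [RHS]esum_mkcond; apply: eq_esum => g _.
  rewrite indicE haar_image_add//.
  case: (boolP (g \in [set` Gamma])) => [/set_mem Gg|/negP nGg]; last first.
    by rewrite memNset// => -[/mem_set].
  case: (boolP (x + g \in H)) => [/set_mem Hg|/negP nHg].
    by rewrite mem_set// mul1e.
  by rewrite mul0e memNset// => -[_ /mem_set].
apply: esum_measure_le.
- move=> g h [Gg _] [Gh _] [y [[p Dp py] [q Dq qy]]].
  apply: (trivIset_packing packD) => //; exists (y - x); split.
    by exists p => //; rewrite -py addrAC [x + g]addrC addrK.
  by exists q => //; rewrite -qy addrAC [x + h]addrC addrK.
- by move=> g _; exact: measurable_image_add.
- exact: measurable_multset.
- move=> g [_ Hg] _ [d Dd <-]; apply: mem_sumset => //; exact: DU.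
Qed.

End LatticeTiling.

(** * The topology of the complex numbers *)

Local Notation normc := ComplexField.Normc.normc.
Local Notation Re := complex.Re.
Local Notation Im := complex.Im.

Section ComplexBasics.
Variable R : realType.
Implicit Types z w : R[i].

Definition sqc z : R := Re z ^+ 2 + Im z ^+ 2.

Lemma normc_sqr z : normc z ^+ 2 = sqc z.
Proof. by case: z => a b; rewrite /= sqr_sqrtr// addr_ge0// sqr_ge0. Qed.

Lemma norm_normc z : `|z| = (normc z)%:C%C. Proof. by case: z. Qed.

Lemma normc_ge0 z : 0 <= normc z.
Proof. by case: z => a b; exact: sqrtr_ge0. Qed.

Lemma sqc_ge0 z : 0 <= sqc z. Proof. by rewrite addr_ge0// sqr_ge0. Qed.

Lemma sqc_eq0 z : (sqc z == 0) = (z == 0).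
Proof. by case: z => a b; rewrite /sqc /= paddr_eq0 ?sqr_ge0// !sqrf_eq0 eq_complex. Qed.

Lemma ReD z w : Re (z + w) = Re z + Re w. Proof. by case: z; case: w. Qed.
Lemma ImD z w : Im (z + w) = Im z + Im w. Proof. by case: z; case: w. Qed.
Lemma ReN z : Re (- z) = - Re z. Proof. by case: z. Qed.
Lemma ImN z : Im (- z) = - Im z. Proof. by case: z. Qed.
Lemma ReM z w : Re (z * w) = Re z * Re w - Im z * Im w.
Proof. by case: z; case: w. Qed.
Lemma ImM z w : Im (z * w) = Re z * Im w + Im z * Re w.
Proof. by case: z; case: w => a b c d /=; rewrite addrC. Qed.
Lemma Re_conjc z : Re (conjc z) = Re z. Proof. by case: z. Qed.
Lemma Im_conjc z : Im (conjc z) = - Im z. Proof. by case: z. Qed.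

Definition complex_partsE := (ReD, ImD, ReN, ImN, ReM, ImM, Re_conjc, Im_conjc).

Lemma complex_ext z w : Re z = Re w -> Im z = Im w -> z = w.
Proof. by case: z; case: w => a b c d /= -> ->. Qed.

Lemma sqcM z w : sqc (z * w) = sqc z * sqc w.
Proof. by rewrite /sqc !complex_partsE; ring. Qed.

Lemma sqc_conjc z : sqc (conjc z) = sqc z.
Proof. by rewrite /sqc !complex_partsE sqrrN. Qed.

Lemma sqcN z : sqc (- z) = sqc z.
Proof. by rewrite /sqc !complex_partsE !sqrrN. Qed.

Lemma normc_sqrt z : normc z = Num.sqrt (sqc z). Proof. by case: z. Qed.

Lemma normcM z w : normc (z * w) = normc z * normc w.
Proof. by rewrite !normc_sqrt sqcM sqrtrM ?sqc_ge0. Qed.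

Lemma abs_Re_le z : `|Re z| <= normc z.
Proof.
rewrite -ler_sqr ?nnegrE ?normc_ge0// normc_sqr real_normK ?num_real//.
by rewrite lerDl sqr_ge0.
Qed.

Lemma abs_Im_le z : `|Im z| <= normc z.
Proof.
rewrite -ler_sqr ?nnegrE ?normc_ge0// normc_sqr real_normK ?num_real//.
by rewrite lerDr sqr_ge0.
Qed.

Lemma complex_gt0P (e : R[i]) : 0 < e -> exists2 r : R, 0 < r & e = r%:C%C.
Proof.
by case: e => a b; rewrite ltcE /= => /andP[/eqP -> a0]; exists a.
Qed.

Lemma ball_complexE z w (r : R) :
  ball (z : R[i]^o) (r%:C%C) w <-> normc (z - w) < r.
Proof. by rewrite -ball_normE /= norm_normc ltcR. Qed.

Lemma nbhs_complexP z (A : set R[i]) :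
  nbhs (z : R[i]^o) A <->
  exists2 r : R, 0 < r & forall w, normc (z - w) < r -> A w.
Proof.
split=> [/nbhs_ballP[e /= /complex_gt0P[r r0 ->] rA]|[r r0 rA]].
  by exists r => // w zw; apply: rA; apply/ball_complexE.
apply/nbhs_ballP; exists r%:C%C; first by rewrite /= ltcR.
by move=> w /ball_complexE; exact: rA.
Qed.

Lemma continuous_Re : continuous (@complex.Re R : R[i]^o -> R).
Proof.
move=> z A /nbhs_ballP[e /= e0 eA]; apply/nbhs_complexP; exists e => // w zw; apply: eA.
by apply: le_lt_trans zw; rewrite /= -ReN -ReD; exact: abs_Re_le.
Qed.

Lemma continuous_Im : continuous (@complex.Im R : R[i]^o -> R).
Proof.
move=> z A /nbhs_ballP[e /= e0 eA]; apply/nbhs_complexP; exists e => // w zw; apply: eA.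
by apply: le_lt_trans zw; rewrite /= -ImN -ImD; exact: abs_Im_le.
Qed.

Lemma continuous_sqc : continuous (sqc : R[i]^o -> R).
Proof.
move=> z; rewrite /sqc; under eq_fun do rewrite !expr2.
apply: (@cvgD _ _ _ (nbhs (z : R[i]^o)) _ (fun z => Re z * Re z) (fun z => Im z * Im z)).
  apply: (@cvgM _ _ (nbhs (z : R[i]^o)) _ (@complex.Re R) (@complex.Re R));
    exact: continuous_Re.
apply: (@cvgM _ _ (nbhs (z : R[i]^o)) _ (@complex.Im R) (@complex.Im R));
  exact: continuous_Im.
Qed.

Lemma precompact_disc : precompact [set z : R[i]^o | sqc z <= 1].
Proof.
have cC : continuous (fun p : R * R => (Complex p.1 p.2 : R[i]^o)).
  move=> [a b]; move=> A /nbhs_complexP[r r0 rA] /=.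
  have r20 : 0 < r / 2 by rewrite divr_gt0.
  exists (ball a (r / 2), ball b (r / 2)); first by split; exact: nbhsx_ballx.
  move=> [c d] [/= ac bd]; apply: rA.
  rewrite normc_sqrt /sqc /=.
  have -> : r = Num.sqrt (r ^+ 2) by rewrite sqrtr_sqr gtr0_norm.
  rewrite ltr_sqrt ?exprn_gt0//.
  move: ac bd; rewrite /ball /= => ac bd.
  rewrite -(@real_normK _ (a - c)) ?num_real// -(@real_normK _ (b - d)) ?num_real//.
  have := normr_ge0 (a - c); have := normr_ge0 (b - d); nra.
exists ((fun p : R * R => (Complex p.1 p.2 : R[i]^o)) @` (`[-1, 1] `*` `[-1, 1])).
  move=> [a b]; rewrite /sqc /= => ab.
  have abnd (u v : R) : u ^+ 2 + v ^+ 2 <= 1 -> -1 <= u <= 1.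
    by move=> uv; apply/andP; split; have := sqr_ge0 v; nra.
  exists (a, b) => //; split; rewrite /= in_itv /=; first exact: abnd ab.
  by apply: (abnd b a); rewrite addrC.
have cI : compact ((fun p : R * R => (Complex p.1 p.2 : R[i]^o)) @` (`[-1, 1] `*` `[-1, 1])).
  apply: continuous_compact; first exact: continuous_subspaceT.
  by apply: compact_setX; exact: segment_compact.
by split=> //; apply: compact_closed => //; exact: norm_hausdorff.
Qed.

End ComplexBasics.

(** * The dual group *)

Section DualTopology.
Context {R : realType} {G : topologicalZmodType}.
Local Notation dual := (dual R G).
Local Notation C := (R[i]^o).

Lemma pairingD x y (w : dual) : pairing (x + y) w = pairing x w * pairing y w.
Proof. by case: (dualP w) => _ _; exact. Qed.

Lemma sqc_pairing x (w : dual) : sqc (pairing x w) = 1.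
Proof.
rewrite -normc_sqr; have := norm_pairing x w; rewrite norm_normc => /complexI ->.
by rewrite expr1n.
Qed.

Lemma pairing0 (w : dual) : pairing 0 w = 1.
Proof.
have := pairingD 0 0 w; rewrite addr0 => /esym/eqP.
rewrite -subr_eq0 -{3}[pairing 0 w]mulr1 -mulrBr mulf_eq0.
by rewrite (negbTE (pairing_neq0 _ _)) /= subr_eq0 => /eqP.
Qed.

Lemma continuous_pairingl (w : dual) : continuous (fun x : G => pairing x w : C).
Proof. by have [c _ _] := dualP w; exact: c. Qed.

Lemma continuous_pairing x : continuous (fun w : dual => pairing x w : C).
Proof.
move=> w; have [cw _ _] := dualP w.
have val_cts : continuous (set_val : dual -> {compact-open, G -> C}).
  exact: (@initial_continuous (set_type (@characters R G)) _ set_val).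
have FF := fmap_filter (set_val : dual -> G -> C) (nbhs_filter w).
have /(compact_open_fam_compactP cw FF) h := @val_cts w.
have /(pointwise_cvgP (set_val w) FF) h2 := pointwise_cvg_compact_family FF h.
exact: h2 x.
Qed.

Lemma hausdorff_dual : hausdorff_space dual.
Proof.
move=> p q pq; apply: dual_eq => x.
apply: (@norm_hausdorff _ (R[i]^o)) => A B nA nB.
have [w [Aw Bw]] := pq _ _ (@continuous_pairing x p A nA) (@continuous_pairing x q B nB).
by exists (pairing x w).
Qed.

(** Stated by pointwise conditions only, so that the set is closed under pointwise
    limits; its members are automatically continuous, uniformly over the set, by the
    angle doubling below. *)
Definition near_trivial (V : set G) : set (G -> C) :=
  [set f | [/\ forall x, sqc (f x) = 1, forall x y, f (x + y) = f x * f y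
             & forall x, V x -> sqc (f x - 1) <= 1]].

(** Angle doubling: if |z| = 1 and |z - 1| <= 1 then |z + 1|^2 >= 3, hence
    |z - 1|^2 <= |z^2 - 1|^2 / 3. A bound at x + x is thus improved by a factor 3
    at x. *)
Lemma near_trivial_small (V : set G) (k : nat) : nbhs 0 V ->
  exists2 U : set G, nbhs 0 U & forall f, near_trivial V f ->
    forall x, U x -> sqc (f x - 1) <= (3^-1) ^+ k.
Proof.
move=> nV.
suff [U nU [UV UP]] : exists2 U : set G, nbhs 0 U & U `<=` V /\
    forall f, near_trivial V f -> forall x, U x -> sqc (f x - 1) <= (3^-1) ^+ k.
  by exists U.
elim: k => [|k [U nU [UV UP]]].
  by exists V => //; split=> // f [_ _ h] x /h; rewrite expr0.
have : nbhs ((0, 0) : G * G) ((fun p : G * G => p.1 + p.2) @^-1` U).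
  by apply: add_continuous; rewrite /= addr0.
move=> [[U1 U2] [/= n1 n2] U12].
exists (U1 `&` U2 `&` V); first by do 2?apply: filterI.
split=> [x []//|f Vf x [[U1x U2x] Vx]].
have := UP f Vf (x + x) (U12 (x, x) (conj U1x U2x)).
have [u m v] := Vf; have := u x; have := v x Vx; rewrite m exprS.
have -> : f x * f x - 1 = (f x - 1) * (f x + 1) by ring.
rewrite sqcM; move: (f x) => z.
rewrite /sqc !complex_partsE /= => h1 h2 h3.
set t := 3^-1 ^+ k in h3 *.
have a2 : 1 <= 2 * Re z by lra.
have e : (Re z + 1) ^+ 2 + (Im z + 0) ^+ 2 = 2 + 2 * Re z by lra.
rewrite e in h3.
have X0 : 0 <= (Re z - 1) ^+ 2 + (Im z - 0) ^+ 2 by rewrite addr_ge0// sqr_ge0.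
have : 0 <= ((Re z - 1) ^+ 2 + (Im z - 0) ^+ 2) * (2 * Re z - 1).
  by rewrite mulr_ge0// subr_ge0.
by lra.
Qed.

(** By multiplicativity equicontinuity at x reduces to equicontinuity at 0. *)
Lemma near_trivial_equicontinuous (V : set G) : nbhs 0 V ->
  equicontinuous (near_trivial V) id.
Proof.
move=> nV x E; rewrite -entourage_ballE => -[e /= /complex_gt0P[r r0 ->] rE].
have [k kP] : exists k, (3^-1 ^+ k < r ^+ 2 :> R).
  have c0 : (fun k => (3^-1 : R) ^+ k) @ \oo --> (0 : R).
    by apply: cvg_expr; rewrite ger0_norm ?invr_ge0// invf_lt1 ?ltr1n.
  have [k _ kP] := cvgr_lt _ c0 _ (exprn_gt0 2 r0).
  by exists k; exact: kP k (leqnn k).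
have [U nU UP] := near_trivial_small k nV.
have : nbhs x ((fun y => y - x) @^-1` U).
  by apply: continuous_subl; rewrite subrr.
apply: filterS => y Uy f Vf; apply: rE; apply/ball_complexE.
have [u m _] := Vf.
have -> : id f x - id f y = - (f x * (f (y - x) - 1)).
  by rewrite /= mulrBr -m [x + _]addrC subrK mulr1 opprB.
rewrite normc_sqrt sqcN sqcM u mul1r.
have -> : r = Num.sqrt (r ^+ 2) by rewrite sqrtr_sqr gtr0_norm.
rewrite ltr_sqrt ?exprn_gt0//.
exact: le_lt_trans (UP f Vf _ Uy) kP.
Qed.

Lemma near_trivial_continuous (V : set G) (f : G -> C) :
  nbhs 0 V -> near_trivial V f -> continuous f.
Proof.
by move=> /near_trivial_equicontinuous h Vf; exact: equicontinuous_continuous h Vf.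
Qed.

Lemma ultra_fmap (T T' : Type) (h : T -> T') (F : set_system T) :
  UltraFilter F -> UltraFilter (h @ F).
Proof.
move=> UF; split=> [|H PH FH]; first exact: fmap_proper_filter.
apply/seteqP; split=> // A HA.
have [//|FC] := in_ultra_setVsetC (h @^-1` A) UF.
have : H (A `&` ~` A) by apply: filterI => //; exact: FH.
by rewrite setICr => /filter_ex[].
Qed.

(** Ascoli's theorem gives a limit of any ultrafilter for uniform convergence on
    compact sets. The limit is again multiplicative, unimodular and near 1 on V, all
    of these being closed pointwise conditions, hence it is a continuous character. *)
Lemma compact_near_trivial (V : set G) : nbhs 0 V ->
  compact [set w : dual | forall x, V x -> sqc (pairing x w - 1) <= 1].
Proof.
move=> nV.
have : precompact (near_trivial V : set {family compact, G -> C}).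
  apply: pointwise_precompact_equicontinuous.
  - exact: norm_hausdorff.
  - move=> x; apply: precompact_subset (precompact_disc R) => z [f [u _ _] <-] /=.
    by rewrite u.
  - exact: near_trivial_equicontinuous.
rewrite precompactE [X in X _ -> _]compact_ultra [X in _ -> X _]compact_ultra => cW F UF FK.
pose FV : set_system (G -> C) := (set_val : dual -> G -> C) @ F.
have WV (w : dual) : (forall x, V x -> sqc (pairing x w - 1) <= 1) ->
    near_trivial V (set_val w).
  move=> h; split=> // [x|x y]; first exact: sqc_pairing.
  exact: pairingD.
have UFV : UltraFilter FV by exact: ultra_fmap.
have FVW : FV (near_trivial V).
  have : F [set w | near_trivial V (set_val w)] by apply: filterS FK => w; exact: WV.
  by [].
have [f [_ Ff]] : closure (near_trivial V : set {family compact, G -> C})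
    `&` [set p | FV --> p] !=set0.
  apply: cW => //; apply: filterS FVW.
  exact: (@subset_closure {family compact, G -> C}).
have FFV : ProperFilter FV by exact: ultra_proper.
have ptw x : (fun g : G -> C => g x) @ FV --> f x.
  have FF : Filter FV by exact: filter_filter.
  have /(pointwise_cvgP f FF) h := pointwise_cvg_compact_family FF Ff.
  exact: h x.
have Wf : near_trivial V f.
  split.
  - move=> x.
    apply: (@closed_cvg _ _ FV _ (fun g : G -> C => g x) [set z | sqc z = 1]) (ptw x).
      apply: (@closed_comp _ _ _ [set 1 : R]); last exact: closed_eq.
      by move=> z _; exact: continuous_sqc.
    by apply: filterS FVW => g [u _ _]; exact: u.
  - move=> x y.
    apply: (@cvg_unique _ (@norm_hausdorff _ (R[i]^o)) (g (x + y) @[g --> FV])).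
      exact: ptw.
    have : (fun g : G -> C => (g x * g y : C)) @ FV --> (f x * f y : C).
      exact: (@cvgM _ _ FV _ (fun g => g x) (fun g => g y)).
    apply: cvg_trans; apply: near_eq_cvg; apply: filterS FVW => g [_ m _].
    by rewrite m.
  - move=> x Vx; apply: (@closed_cvg _ _ FV _ (fun g : G -> C => g x)
        [set z | sqc (z - 1) <= 1]) (ptw x).
      apply: (@closed_comp _ _ (fun z : C => sqc (z - 1)) [set t : R | t <= 1]);
        last exact: closed_le.
      move=> z _; apply: (@continuous_comp _ _ _ (fun z : C => z - 1 : C));
        last exact: continuous_sqc.
      move=> A /nbhs_complexP[r r0 rA]; apply/nbhs_complexP; exists r => // v zv.
      by apply: rA; rewrite opprB addrA subrK.
    by apply: filterS FVW => g [_ _ v]; exact: v.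
have cf : continuous f := near_trivial_continuous nV Wf.
have chf : characters f.
  case: Wf => u m _; split=> // x.
  by rewrite norm_normc normc_sqrt u sqrtr1.
pose w0 : dual := SigSub (mem_set chf).
exists w0; split; first by case: Wf.
have : {compact-open, FV --> f}.
  by apply/(compact_open_fam_compactP cf) => //.
move=> FO A /= ; rewrite nbhsE => -[B [[Q oQ QB] Bw] BA].
apply: filterS BA _; rewrite -QB; apply: FO; apply: open_nbhs_nbhs; split=> //.
by move: Bw; rewrite -QB.
Qed.

End DualTopology.

Section DualSigmaCompact.
Context {R : realType} {G : topologicalZmodType}.
Hypothesis scG : @second_countable G.
Local Notation dual := (dual R G).
Local Notation C := (R[i]^o).

Lemma continuous_sqc_pairing_sub (x : G) (e : dual) :
  continuous (fun w : dual => sqc (pairing x e - pairing x w)).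
Proof.
move=> w; apply: (@continuous_comp _ _ _ (fun w : dual => pairing x e - pairing x w : C)).
  move=> A /nbhs_complexP[r r0 rA].
  have h : nbhs (pairing x w : C) [set z | normc (pairing x w - z) < r].
    by apply/nbhs_complexP; exists r.
  have hw : nbhs w [set v : dual | normc (pairing x w - pairing x v) < r].
    exact: (@continuous_pairing R G x w _ h).
  apply: (@filterS _ (nbhs w) _ _ _ _ hw) => v /= wv.
  apply: rA; rewrite opprB addrC addrA subrK.
  by rewrite normc_sqrt -sqcN opprB -normc_sqrt.
exact: continuous_sqc.
Qed.

Lemma dual_eq_dense (xi : nat -> G) (e w : dual) :
  (forall U, open U -> U !=set0 -> exists n, U (xi n)) ->
  (forall n, sqc (pairing (xi n) e - pairing (xi n) w) = 0) -> e = w.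
Proof.
move=> dxi h; apply: dual_eq => x; apply: contrapT => /eqP xe.
pose U := [set x : G | pairing x e - pairing x w != 0].
have oU : open U.
  have -> : U = ~` ((fun x : G => pairing x e / pairing x w : C) @^-1` [set 1]).
    apply/seteqP; split=> y.
      move=> yU ew1; move: yU; rewrite /U /mkset.
      have ew : pairing y e / pairing y w = 1 by [].
      have -> : pairing y e = pairing y w.
        by rewrite -[LHS](divfK (pairing_neq0 y w)) ew mul1r.
      by rewrite subrr eqxx.
    move=> ne; apply/negP; rewrite subr_eq0 => /eqP ew; apply: ne.
    by rewrite /preimage /mkset ew mulfV//; exact: pairing_neq0.
  apply: closed_openC; apply: closed_comp; last first.
    by apply: (@compact_closed C); [exact: norm_hausdorff|exact: compact_set1].
  by move=> y _; exact: (@continuous_pairingl R G (e - w)).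
have [|n] := dxi U oU; first by exists x; rewrite /U /= subr_eq0.
by rewrite /U /= -sqc_eq0 h eqxx.
Qed.

(** By continuity every character is near 1 on some member of a countable basis of
    neighbourhoods of 0. *)
Lemma dual_sigma_compact : exists2 K : nat -> set dual,
  forall n, compact (K n) & \bigcup_n K n = setT.
Proof.
have [b bo bP] := second_countable_basis scG.
pose V n := if `[< b n 0 >] then b n else setT.
exists (fun n => [set w : dual | forall x, V n x -> sqc (pairing x w - 1) <= 1]).
  move=> n; apply: compact_near_trivial; rewrite /V.
  case: ifPn => [/asboolP b0|_]; last exact: filterT.
  by apply: open_nbhs_nbhs; split.
apply/seteqP; split=> // w _.
have : nbhs (0 : G) [set x | sqc (pairing x w - 1) <= 1].
  have h : nbhs (1 : C) [set z | sqc (z - 1) <= 1].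
    apply/nbhs_complexP; exists 1 => // z z1.
    rewrite /= -sqcN opprB -normc_sqr expr_le1//; first exact: ltW.
    exact: normc_ge0.
  have := @continuous_pairingl R G w 0; rewrite /continuous_at pairing0.
  by move=> /(_ _ h).
move=> /bP[n bn0 bn]; exists n => // x.
by rewrite /V (asboolT bn0) => /bn.
Qed.

(** On a compact set K of characters the topology is that of pointwise convergence on
    a dense sequence, so the points of K outside E are exhausted by those whose
    distance to E, measured on the first k members of the sequence, is at least
    1/(k+1). *)
Lemma open_dual_sigma_compact (E : set dual) : closed E ->
  exists K : nat -> nat -> set dual,
    [/\ forall n k, compact (K n k), forall n k, K n k `<=` ~` E
      & ~` E `<=` \bigcup_n \bigcup_k K n k].
Proof.
move=> cE; have [K cK KT] := dual_sigma_compact.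
have [xi dxi _] := dense_sequence scG.
pose D k (e w : dual) : R := \sum_(i < k) sqc (pairing (xi i) e - pairing (xi i) w).
have D0 k e w : 0 <= D k e w by apply: sumr_ge0 => i _; exact: sqc_ge0.
have Dle k l e w : (k <= l)%N -> D k e w <= D l e w.
  move=> kl; rewrite /D -(subnKC kl) big_split_ord /= lerDl.
  by apply: sumr_ge0 => i _; exact: sqc_ge0.
have Dsym k e w : D k e w = D k w e.
  by apply: eq_bigr => i _; rewrite -sqcN opprB.
have Dcts k e : continuous (D k e).
  elim: k => [|k IH].
    rewrite (_ : D 0%N e = cst 0); first exact: cst_continuous.
    by apply/funext => w; rewrite /D big_ord0.
  rewrite (_ : D k.+1 e =
      (fun w => D k e w + sqc (pairing (xi k) e - pairing (xi k) w))).
    move=> w; apply: (@cvgD _ _ _ (nbhs w)); first exact: IH.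
    exact: continuous_sqc_pairing_sub.
  by apply/funext => w; rewrite /D big_ord_recr.
exists (fun n k => K n `&` \bigcap_(e in E `&` K n) [set w | k.+1%:R^-1 <= D k e w]).
split.
- move=> n k; apply: compact_closedI => //; apply: closed_bigI => e _.
  apply: (@closed_comp _ _ (D k e) [set t : R | k.+1%:R^-1 <= t]); last exact: closed_ge.
  by move=> w _; exact: Dcts.
- move=> n k w [Kw h] Ew; have /= := h w (conj Ew Kw).
  rewrite /D big1; last by move=> i _; rewrite subrr /sqc /= expr0n addr0.
  by rewrite leNgt invr_gt0 ltr0n.
move=> w Ew; have [n _ Kw] : (\bigcup_n K n) w by rewrite KT.
exists n => //.
have [||||k kP] := @compact_increasing_cover _ (E `&` K n)
  (fun k => [set e | k.+1%:R^-1 < D k w e]).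
- by rewrite setIC; apply: compact_closedI.
- move=> k; apply: (@open_comp _ _ (D k w) [set t : R | k.+1%:R^-1 < t]); last exact: open_gt.
  by move=> v _; exact: Dcts.
- move=> k l kl e /= ke; apply: le_lt_trans (lt_le_trans ke (Dle _ _ _ _ kl)).
  by rewrite lef_pV2 ?posrE ?ltr0n// ler_nat ltnS.
- move=> e [Ee _].
  have [i si] : exists i, sqc (pairing (xi i) w - pairing (xi i) e) != 0.
    apply: contrapT => h; apply: Ew; rewrite (_ : w = e)//.
    apply: (dual_eq_dense dxi) => i; apply/eqP; apply: contrapT => /negP hi.
    by apply: h; exists i.
  set s := sqc _ in si.
  have s0 : 0 < s by rewrite lt0r si sqc_ge0.
  pose m := Num.truncn s^-1.
  have sD k : (i < k)%N -> s <= D k w e.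
    move=> ik; rewrite /D (bigD1 (Ordinal ik))//= lerDl.
    by apply: sumr_ge0 => j _; exact: sqc_ge0.
  exists (maxn i.+1 m) => //=.
  apply: lt_le_trans (sD _ _); last by rewrite leq_maxl.
  rewrite -[s]invrK ltf_pV2 ?posrE ?invr_gt0 ?ltr0n//.
  apply: lt_le_trans (truncnS_gt _) _.
  by rewrite ler_nat ltnS leq_maxr.
exists k => //; split=> // e eEK /=; rewrite Dsym; apply: ltW; exact: kP.
Qed.

End DualSigmaCompact.

(** Whether k x t > a can be tested on a basic neighbourhood of x through a countable
    dense set, which writes the set of such pairs as a countable union of rectangles. *)
Lemma measurable_caratheodory {R : realType} {G : topologicalZmodType}
    {d : measure_display} {T : measurableType d} (k : G -> T -> R) :
  @second_countable G -> (forall t, continuous (k^~ t)) ->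
  (forall x, measurable_fun setT (k x)) ->
  measurable_fun setT (fun p : borel G * T => k p.1 p.2).
Proof.
move=> scG ck mk; apply: (measurability _ (RGenOInfty.measurableE R)) => //.
move=> _ [_ [a ->] <-]; rewrite setTI.
have [b bo bP] := second_countable_basis scG.
have [xi dxi _] := dense_sequence scG.
pose S n m := \bigcap_(l in [set l | b n (xi l)]) [set t | a + m.+1%:R^-1 <= k (xi l) t].
have mS n m : measurable (S n m).
  apply: bigcap_measurableType => l _; rewrite -[X in measurable X]setTI.
  rewrite (_ : [set t | _] = k (xi l) @^-1` `[a + m.+1%:R^-1, +oo[); last first.
    by apply/seteqP; split=> t /=; rewrite in_itv /= andbT.
  by apply: mk => //; exact: measurable_itv.
rewrite (_ : _ @^-1` _ = \bigcup_n \bigcup_m ((b n : set (borel G)) `*` S n m)).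
  apply: bigcupT_measurable => n; apply: bigcupT_measurable => m.
  by apply: measurableX => //; exact: borel_open.
apply/seteqP; split=> -[x t] /=.
  rewrite in_itv /= andbT => ak.
  have [m mP] : exists m : nat, a + m.+1%:R^-1 < k x t.
    exists (Num.truncn (k x t - a)^-1).
    rewrite -ltrBrDl -[ltRHS]invrK ltf_pV2 ?posrE ?invr_gt0 ?subr_gt0 ?ltr0n//.
    exact: truncnS_gt.
  have : nbhs x [set y | a + m.+1%:R^-1 < k y t].
    apply: (ck t x [set z | a + m.+1%:R^-1 < z]).
    by apply: open_nbhs_nbhs; split=> //; exact: open_gt.
  move=> /bP[n bx bn]; exists n => //; exists m => //; split=> //= l /bn /=.
  exact: ltW.
move=> [n _ [m _ [/= bx h]]]; rewrite in_itv /= andbT.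
apply: (@lt_le_trans _ _ (a + m.+1%:R^-1)); first by rewrite ltrDl invr_gt0.
rewrite leNgt; apply/negP => lt.
have oU : open (b n `&` [set y | k y t < a + m.+1%:R^-1]).
  apply: openI => //; apply: (@open_comp _ _ (k^~ t) [set z | z < a + m.+1%:R^-1]).
    by move=> y _; exact: ck.
  exact: open_lt.
have [|l [bl /=]] := dxi _ oU; first by exists x.
by rewrite ltNge (h l bl).
Qed.

(** * Square integrable complex functions *)

Section SquareIntegrable.
Context {R : realType} {d : measure_display} {T : measurableType d}.
Variable mu : {measure set T -> \bar R}.
Implicit Types f g h : T -> R[i].

Lemma cmeasurableD f g : cmeasurable f -> cmeasurable g ->
  cmeasurable (fun x => f x + g x).
Proof.
move=> [fr fi] [gr gi]; split.
  by under eq_fun do rewrite ReD; exact: measurable_funD.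
by under eq_fun do rewrite ImD; exact: measurable_funD.
Qed.

Lemma cmeasurableM f g : cmeasurable f -> cmeasurable g ->
  cmeasurable (fun x => f x * g x).
Proof.
move=> [fr fi] [gr gi]; split.
  by under eq_fun do rewrite ReM; apply: measurable_funB; exact: measurable_funM.
by under eq_fun do rewrite ImM; apply: measurable_funD; exact: measurable_funM.
Qed.

Lemma cmeasurable_conjc f : cmeasurable f -> cmeasurable (fun x => conjc (f x)).
Proof.
move=> [fr fi]; split.
  by under eq_fun do rewrite Re_conjc.
by under eq_fun do rewrite Im_conjc; exact: measurable_funN.
Qed.

Lemma cmeasurable_cst (c : R[i]) : cmeasurable (fun _ : T => c).
Proof. by split; exact: measurable_cst. Qed.

Lemma cmeasurable_indic (A : set T) : measurable A ->
  cmeasurable (fun x => ((\1_A x : R)%:C)%C).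
Proof.
by move=> mA; split => /=; [exact: measurable_indic|exact: measurable_cst].
Qed.

Lemma measurable_sqc f : cmeasurable f -> measurable_fun setT (fun x => sqc (f x)).
Proof.
move=> [fr fi]; rewrite /sqc.
by apply: measurable_funD; exact: measurable_funX.
Qed.

Lemma measurable_normc f : cmeasurable f -> measurable_fun setT (fun x => normc (f x)).
Proof.
move=> mf; under eq_fun do rewrite normc_sqrt.
apply: measurableT_comp; first exact: (continuous_measurable_fun (@sqrt_continuous R)).
exact: measurable_sqc.
Qed.

Lemma sqnorm2E f : sqnorm2 mu f = (\int[mu]_x (sqc (f x))%:E)%E.
Proof. by apply: eq_integral => x _; rewrite normc_sqr. Qed.

Lemma sqnorm2_ge0 f : (0 <= sqnorm2 mu f)%E.
Proof. by apply: integral_ge0 => x _; rewrite lee_fin sqr_ge0. Qed.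

Lemma L2_integrable_sqc f : L2 mu f -> mu.-integrable setT (fun x => (sqc (f x))%:E).
Proof.
move=> [mf]; rewrite sqnorm2E => foo; apply/integrableP; split.
  by apply/measurable_EFinP; exact: measurable_sqc.
under eq_integral do rewrite gee0_abs ?lee_fin ?sqc_ge0//.
exact: foo.
Qed.

Lemma L2_dominated f h1 h2 (c : R) : cmeasurable f -> L2 mu h1 -> L2 mu h2 ->
  (forall x, sqc (f x) <= c * (sqc (h1 x) + sqc (h2 x))) -> L2 mu f.
Proof.
move=> mf h1L h2L fh; split=> //; rewrite sqnorm2E.
have ih : mu.-integrable setT (fun x => (c * (sqc (h1 x) + sqc (h2 x)))%:E).
  under eq_fun do rewrite EFinM; apply: integrableZl => //.
  under eq_fun do rewrite EFinD.
  by apply: integrableD => //; exact: L2_integrable_sqc.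
apply: le_lt_trans (integrable_lty measurableT ih).
apply: ge0_le_integral => //.
- by move=> x _; rewrite lee_fin sqc_ge0.
- by apply/measurable_EFinP; exact: measurable_sqc.
- by case/integrableP: ih.
- by move=> x _; rewrite lee_fin.
Qed.

Lemma sqcD_le (z w : R[i]) : sqc (z + w) <= 2 * (sqc z + sqc w).
Proof.
rewrite /sqc !complex_partsE.
have := sqr_ge0 (Re z - Re w); have := sqr_ge0 (Im z - Im w); nra.
Qed.

Lemma L2D f g : L2 mu f -> L2 mu g -> L2 mu (fun x => f x + g x).
Proof.
move=> fL gL; apply: (@L2_dominated _ f g 2) => //.
  by apply: cmeasurableD; [case: fL|case: gL].
by move=> x; exact: sqcD_le.
Qed.

Lemma L2M f h (c : R) : L2 mu f -> cmeasurable h -> (forall x, sqc (h x) <= c) ->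
  L2 mu (fun x => h x * f x).
Proof.
move=> fL mh hc; apply: (@L2_dominated _ f f c) => //.
  by apply: cmeasurableM => //; case: fL.
move=> x; rewrite sqcM.
by have := hc x; have := sqc_ge0 (h x); have := sqc_ge0 (f x); nra.
Qed.

Lemma L2Mr f h (c : R) : L2 mu f -> cmeasurable h -> (forall x, sqc (h x) <= c) ->
  L2 mu (fun x => f x * h x).
Proof. by move=> fL mh hc; under eq_fun do rewrite mulrC; exact: L2M hc. Qed.

Lemma integrable_comb (a b : R) (r s : T -> R) :
  mu.-integrable setT (fun x => (r x)%:E) -> mu.-integrable setT (fun x => (s x)%:E) ->
  mu.-integrable setT (fun x => (a * r x + b * s x)%:E).
Proof.
move=> ir is_; under eq_fun do rewrite EFinD !EFinM.
by apply: integrableD => //; exact: integrableZl.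
Qed.

Lemma L2Z (a : R[i]) f : L2 mu f -> L2 mu (fun x => a * f x).
Proof. by move=> fL; apply: (@L2M _ _ (sqc a)) => //; exact: cmeasurable_cst. Qed.

Lemma normc_prod_le (z w : R[i]) : normc (z * conjc w) <= sqc z + sqc w.
Proof.
rewrite normcM ![normc _]normc_sqrt sqc_conjc.
have := sqr_sqrtr (sqc_ge0 z); have := sqr_sqrtr (sqc_ge0 w).
have := sqrtr_ge0 (sqc z); have := sqrtr_ge0 (sqc w).
move: (Num.sqrt _) (Num.sqrt _) => a b a0 b0 <- <-.
by have := sqr_ge0 (a - b); nra.
Qed.

Lemma L2_integrable_prod f g : L2 mu f -> L2 mu g ->
  mu.-integrable setT (fun x => (Re (f x * conjc (g x)))%:E) /\
  mu.-integrable setT (fun x => (Im (f x * conjc (g x)))%:E).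
Proof.
move=> fL gL.
have ih : mu.-integrable setT (fun x => (sqc (f x) + sqc (g x))%:E).
  under eq_fun do rewrite EFinD.
  by apply: integrableD => //; exact: L2_integrable_sqc.
have [mr mi] : cmeasurable (fun x => f x * conjc (g x)).
  by apply: cmeasurableM; [case: fL|apply: cmeasurable_conjc; case: gL].
have bnd x : (normc (f x * conjc (g x)) <= `|sqc (f x) + sqc (g x)|).
  rewrite ger0_norm; last exact: addr_ge0 (sqc_ge0 _) (sqc_ge0 _).
  exact: normc_prod_le.
split; apply: le_integrable ih => //; try exact/measurable_EFinP; move=> x _.
  by apply: le_trans (_ : (normc (f x * conjc (g x)))%:E <= _)%E;
    rewrite lee_fin//; exact: abs_Re_le.
by apply: le_trans (_ : (normc (f x * conjc (g x)))%:E <= _)%E;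
  rewrite lee_fin//; exact: abs_Im_le.
Qed.

(** Polarization: a = 1 and a = 'i recover the two parts of the inner product from
    norms. *)
Lemma sqnorm2_comb (a : R[i]) f g : L2 mu f -> L2 mu g ->
  fine (sqnorm2 mu (fun x => a * f x + g x)) =
  sqc a * fine (sqnorm2 mu f) + fine (sqnorm2 mu g) +
  2 * (Re a * Re (inner mu f g) - Im a * Im (inner mu f g)).
Proof.
move=> fL gL; rewrite !sqnorm2E.
have [ir ii] := L2_integrable_prod fL gL.
have if2 := L2_integrable_sqc fL; have ig2 := L2_integrable_sqc gL.
have i1 : mu.-integrable setT (EFin \o (fun x => sqc a * sqc (f x))).
  by rewrite /comp; under eq_fun do rewrite EFinM; exact: integrableZl.
have i2 : mu.-integrable setT (EFin \o (fun x => sqc a * sqc (f x) + sqc (g x))).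
  by rewrite /comp; under eq_fun do rewrite EFinD; exact: integrableD.
have i3 : mu.-integrable setT (EFin \o (fun x => (2 * Re a) * Re (f x * conjc (g x)))).
  by rewrite /comp; under eq_fun do rewrite EFinM; exact: integrableZl.
have i4 : mu.-integrable setT (EFin \o (fun x => (2 * Im a) * Im (f x * conjc (g x)))).
  by rewrite /comp; under eq_fun do rewrite EFinM; exact: integrableZl.
have i5 : mu.-integrable setT (EFin \o (fun x => (2 * Re a) * Re (f x * conjc (g x)) -
     (2 * Im a) * Im (f x * conjc (g x)))).
  by rewrite /comp; under eq_fun do rewrite EFinB; exact: integrableB.
transitivity (\int[mu]_x ((sqc a * sqc (f x) + sqc (g x)) +
    ((2 * Re a) * Re (f x * conjc (g x)) -
     (2 * Im a) * Im (f x * conjc (g x))))).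
  apply: eq_Rintegral => x _.
  by rewrite /sqc !complex_partsE; ring.
rewrite RintegralD// RintegralD// RintegralB// !RintegralZl//.
by rewrite /inner /cintegral /= /Rintegral; ring.
Qed.

Lemma ae_imp (P Q : T -> Prop) : (forall x, P x -> Q x) ->
  {ae mu, forall x, P x} -> {ae mu, forall x, Q x}.
Proof. by move=> PQ; apply: filterS => x; exact: PQ. Qed.

Lemma ae_imp2 (P Q S : T -> Prop) : (forall x, P x -> Q x -> S x) ->
  {ae mu, forall x, P x} -> {ae mu, forall x, Q x} -> {ae mu, forall x, S x}.
Proof. by move=> PQ; apply: filterS2 => x; exact: PQ. Qed.

Lemma sqnorm2_ae f g : cmeasurable f -> cmeasurable g ->
  {ae mu, forall x, f x = g x} -> sqnorm2 mu f = sqnorm2 mu g.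
Proof.
move=> mf mg fg; rewrite !sqnorm2E; apply: ge0_ae_eq_integral => //.
- by apply/measurable_EFinP; exact: measurable_sqc.
- by apply/measurable_EFinP; exact: measurable_sqc.
- by move=> x _; rewrite lee_fin sqc_ge0.
- by move=> x _; rewrite lee_fin sqc_ge0.
- by move: fg; apply: filterS => x /= ->.
Qed.

Lemma inner_ae f f' g g' : cmeasurable f -> cmeasurable f' ->
  cmeasurable g -> cmeasurable g' ->
  {ae mu, forall x, f x = f' x} -> {ae mu, forall x, g x = g' x} ->
  inner mu f g = inner mu f' g'.
Proof.
move=> mf mf' mg mg' ff' gg'.
have [mr mi] := cmeasurableM mf (cmeasurable_conjc mg).
have [mr' mi'] := cmeasurableM mf' (cmeasurable_conjc mg').
rewrite /inner /cintegral /Rintegral; congr (Complex (fine _) (fine _)).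
  apply: ae_eq_integral => //; try exact/measurable_EFinP.
  by move: ff' gg'; apply: filterS2 => x -> ->.
apply: ae_eq_integral => //; try exact/measurable_EFinP.
by move: ff' gg'; apply: filterS2 => x -> ->.
Qed.

Lemma sqnorm2_eq0 f : cmeasurable f -> sqnorm2 mu f = 0%E ->
  {ae mu, forall x, f x = 0}.
Proof.
move=> mf; rewrite sqnorm2E => f0.
have mE : measurable_fun setT (fun x => (sqc (f x))%:E).
  by apply/measurable_EFinP; exact: measurable_sqc.
have [+ _] := ae_eq_integral_abs mu measurableT mE.
under eq_integral do rewrite gee0_abs ?lee_fin ?sqc_ge0//.
move=> /(_ f0); apply: filterS => x /(_ I) /= [] /eqP.
by rewrite sqc_eq0 => /eqP.
Qed.

Lemma innerC f g : L2 mu f -> L2 mu g -> inner mu g f = conjc (inner mu f g).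
Proof.
move=> fL gL; have [ir ii] := L2_integrable_prod fL gL.
rewrite /inner /cintegral; apply: complex_ext => /=.
  by apply: eq_Rintegral => x _; rewrite !complex_partsE; ring.
rewrite -[RHS]mulN1r -RintegralZl//.
by apply: eq_Rintegral => x _; rewrite !complex_partsE; ring.
Qed.

Lemma cintegralZ (c : R[i]) f :
  mu.-integrable setT (fun x => (Re (f x))%:E) ->
  mu.-integrable setT (fun x => (Im (f x))%:E) ->
  cintegral mu (fun x => c * f x) = c * cintegral mu f.
Proof.
move=> ir ii.
have iZ (a : R) (h : T -> R) : mu.-integrable setT (EFin \o h) ->
    mu.-integrable setT (EFin \o (fun x => a * h x)).
  by move=> ih; rewrite /comp; under eq_fun do rewrite EFinM; exact: integrableZl.
have ir' : mu.-integrable setT (EFin \o (fun x => Re (f x))) by [].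
have ii' : mu.-integrable setT (EFin \o (fun x => Im (f x))) by [].
apply: complex_ext; rewrite (ReM, ImM).
  rewrite -[RHS]/(Re c * (\int[mu]_x Re (f x)) - Im c * (\int[mu]_x Im (f x))).
  rewrite -!RintegralZl// -RintegralB//; try exact: iZ.
  by apply: eq_Rintegral => x _; rewrite ReM.
rewrite -[RHS]/(Re c * (\int[mu]_x Im (f x)) + Im c * (\int[mu]_x Re (f x))).
rewrite -!RintegralZl// -RintegralD//; try exact: iZ.
by apply: eq_Rintegral => x _; rewrite ImM.
Qed.

End SquareIntegrable.

(** * The Plancherel transform *)

Section Plancherel.
Context {R : realType} {G : topologicalZmodType}.
Variable mu : {measure set (borel G) -> \bar R}.
Hypothesis haar_mu : haar_measure mu.
Variable nu : {measure set (borel (dual R G)) -> \bar R}.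
Variable F : (G -> R[i]) -> (dual R G -> R[i]).
Hypothesis planF : is_plancherel_transform mu nu F.
Implicit Types f g : G -> R[i].

Lemma plancherel_L2 f : L2 mu f -> L2 nu (F f).
Proof. by case: planF => + _ _ _ _; exact. Qed.

Lemma plancherel_sqnorm2 f : L2 mu f -> sqnorm2 nu (F f) = sqnorm2 mu f.
Proof. by case: planF => _ _ _ + _; exact. Qed.

Lemma plancherel_comb a f g : L2 mu f -> L2 mu g ->
  sqnorm2 nu (fun w => a * F f w + F g w) = sqnorm2 mu (fun x => a * f x + g x).
Proof.
move=> fL gL; case: (planF) => _ _ lin _ _.
have cL : L2 mu (fun x => a * f x + g x) by apply: L2D => //; exact: L2Z.
rewrite -plancherel_sqnorm2//; apply/esym/sqnorm2_ae; last exact: lin.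
  by case: (plancherel_L2 cL).
by case: (L2D (L2Z a (plancherel_L2 fL)) (plancherel_L2 gL)).
Qed.

Lemma parseval f g : L2 mu f -> L2 mu g -> inner nu (F f) (F g) = inner mu f g.
Proof.
move=> fL gL.
have pol a : Re a * Re (inner nu (F f) (F g)) - Im a * Im (inner nu (F f) (F g)) =
             Re a * Re (inner mu f g) - Im a * Im (inner mu f g).
  have := congr1 fine (plancherel_comb a fL gL).
  rewrite sqnorm2_comb//; [|exact: plancherel_L2..].
  rewrite sqnorm2_comb// !plancherel_sqnorm2//.
  by move=> /addrI /(mulfI _); apply; rewrite pnatr_eq0.
apply: complex_ext.
  by have := pol 1; rewrite /= !mul1r !mul0r !subr0.
by have := pol 'i%C; rewrite /= !mul1r !mul0r !add0r => /oppr_inj.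
Qed.

(** ** Translations *)

Lemma integral_translate (f : G -> \bar R) (a : G) :
  measurable_fun setT (f : borel G -> \bar R) ->
  (\int[mu]_x f (x - a)%R = \int[mu]_x f x)%E.
Proof.
move=> mf; rewrite [LHS]integralE [RHS]integralE.
congr (_ - _)%E.
  rewrite -(ge0_integral_translate haar_mu a (measurable_funepos mf) (funepos_ge0 _)).
  by apply: eq_integral => x _; rewrite !funeposE.
rewrite -(ge0_integral_translate haar_mu a (measurable_funeneg mf) (funeneg_ge0 _)).
by apply: eq_integral => x _; rewrite !funenegE.
Qed.

Lemma cmeasurable_translate (a : G) f : cmeasurable (f : borel G -> R[i]) ->
  cmeasurable (translate a f : borel G -> R[i]).
Proof.
move=> [mr mi]; rewrite /translate; split.
  exact: (measurableT_comp mr (measurable_subl a)).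
exact: (measurableT_comp mi (measurable_subl a)).
Qed.

Lemma cintegral_translate (a : G) f : cmeasurable (f : borel G -> R[i]) ->
  cintegral mu (translate a f) = cintegral mu f.
Proof.
move=> [mr mi]; rewrite /cintegral /Rintegral /translate; congr (Complex (fine _) (fine _)).
  by apply: (@integral_translate (fun x => (Re (f x))%:E)); exact/measurable_EFinP.
by apply: (@integral_translate (fun x => (Im (f x))%:E)); exact/measurable_EFinP.
Qed.

Lemma sqnorm2_translate (a : G) f : cmeasurable (f : borel G -> R[i]) ->
  sqnorm2 mu (translate a f) = sqnorm2 mu f.
Proof.
move=> mf; rewrite !sqnorm2E.
apply: (@integral_translate (fun x => (sqc (f x))%:E)).
by apply/measurable_EFinP; exact: measurable_sqc.
Qed.

Lemma L2_translate (a : G) f : L2 mu f -> L2 mu (translate a f).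
Proof.
move=> [mf foo]; split; first exact: cmeasurable_translate.
by rewrite sqnorm2_translate.
Qed.

Lemma inner_translate (a : G) f g :
  cmeasurable (f : borel G -> R[i]) -> cmeasurable (g : borel G -> R[i]) ->
  inner mu (translate a f) (translate a g) = inner mu f g.
Proof.
move=> mf mg; rewrite /inner -[RHS](cintegral_translate a)//.
by apply: cmeasurableM => //; exact: cmeasurable_conjc.
Qed.

Lemma cmeasurable_pairingl (w : dual R G) :
  cmeasurable ((fun x => pairing x w) : borel G -> R[i]).
Proof.
split; apply: measurable_continuous_real => x.
  apply: (@continuous_comp _ _ _ (fun x => pairing x w : R[i]^o)).
    exact: continuous_pairingl.
  exact: continuous_Re.
apply: (@continuous_comp _ _ _ (fun x => pairing x w : R[i]^o)).
  exact: continuous_pairingl.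
exact: continuous_Im.
Qed.

Lemma cmeasurable_pairing (x : G) :
  cmeasurable ((fun w => pairing x w) : borel (dual R G) -> R[i]).
Proof.
split; apply: measurable_continuous_real => w.
  apply: (@continuous_comp _ _ _ (fun w => pairing x w : R[i]^o)).
    exact: continuous_pairing.
  exact: continuous_Re.
apply: (@continuous_comp _ _ _ (fun w => pairing x w : R[i]^o)).
  exact: continuous_pairing.
exact: continuous_Im.
Qed.

Lemma L1_integrable (f : G -> R[i]) : L1 mu f ->
  mu.-integrable setT (fun x : borel G => (Re (f x))%:E) /\
  mu.-integrable setT (fun x : borel G => (Im (f x))%:E).
Proof.
move=> [[mr mi] foo].
have mn : measurable_fun setT (fun x : borel G => normc (f x)). exact: measurable_normc.
have ih : mu.-integrable setT (fun x : borel G => (normc (f x))%:E).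
  apply/integrableP; split; first exact/measurable_EFinP.
  by under eq_integral do rewrite gee0_abs ?lee_fin ?normc_ge0//.
split; apply: le_integrable ih => //; try exact/measurable_EFinP;
  move=> x _; rewrite /= lee_fin [leRHS]ger0_norm ?normc_ge0//.
  exact: abs_Re_le.
exact: abs_Im_le.
Qed.

Lemma fourier_translate (a : G) f (w : dual R G) : L1 mu f ->
  fourier mu (translate a f) w = conjc (pairing a w) * fourier mu f w.
Proof.
move=> fL; have [mf _] := fL; rewrite /fourier.
pose h x := f x * conjc (pairing x w).
have mh : cmeasurable (h : borel G -> R[i]).
  by apply: cmeasurableM => //; apply: cmeasurable_conjc; exact: cmeasurable_pairingl.
have hL : L1 mu h.
  split=> //; case: fL => _; apply: le_lt_trans.
  rewrite le_eqVlt; apply/orP; left; apply/eqP; apply: eq_integral => x _.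
  by rewrite /h normcM [X in _ * X]normc_sqrt sqc_conjc sqc_pairing sqrtr1 mulr1.
have [ir ii] := L1_integrable hL.
rewrite (_ : (fun x : borel G => _) =
    fun x => conjc (pairing a w) * translate a h x); last first.
  apply/funext => x; rewrite /translate /h.
  have -> : pairing x w = pairing (x - a) w * pairing a w.
    by rewrite -pairingD subrK.
  by rewrite rmorphM [RHS]mulrC -mulrA.
rewrite -[X in _ = _ * X](cintegral_translate a mh).
have [tr ti] : mu.-integrable setT (fun x : borel G => (Re (translate a h x))%:E) /\
  mu.-integrable setT (fun x : borel G => (Im (translate a h x))%:E).
  apply: L1_integrable; split; first exact: cmeasurable_translate.
  have [mhh hoo] := hL.
  rewrite (@integral_translate (fun x => (normc (h x))%:E))//.
  apply/measurable_EFinP; exact: measurable_normc.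
exact: cintegralZ.
Qed.

End Plancherel.

(** * Fubini on a product of sets of finite measure *)

Section FubiniFinite.
Context {R : realType}.

Lemma integral_mfrestr {d} {T : measurableType d} (m : {measure set T -> \bar R})
    (D : set T) (mD : measurable D) (Doo : (m D < +oo)%E) (f : T -> \bar R) :
  (forall x, ~ D x -> f x = 0%E) ->
  (\int[mfrestr mD Doo]_x f x = \int[m]_x f x)%E.
Proof.
move=> f0.
have fE : f = f \_ D.
  by apply/funext => x; rewrite patchE; case: ifPn => // /negP xD; apply: f0 => /mem_set.
rewrite fE -!integral_mkcond; apply: eq_measure_integral => A mA AD.
by rewrite /= /mfrestr /mrestr setIidl.
Qed.

Context {d1 d2} {T1 : measurableType d1} {T2 : measurableType d2}.
Variables (m1 : {measure set T1 -> \bar R}) (m2 : {measure set T2 -> \bar R}).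
Variables (A1 : set T1) (A2 : set T2) (k : T1 -> T2 -> R) (H : T2 -> R).
Hypotheses (mA1 : measurable A1) (A1oo : (m1 A1 < +oo)%E).
Hypotheses (mA2 : measurable A2) (A2oo : (m2 A2 < +oo)%E).
Hypotheses (mk : measurable_fun setT (fun p : T1 * T2 => k p.1 p.2))
  (k0 : forall x y, ~ (A1 x /\ A2 y) -> k x y = 0)
  (H0 : forall y, ~ A2 y -> H y = 0)
  (iH : m2.-integrable setT (fun y => (H y)%:E))
  (kH : forall x y, `|k x y| <= H y).

Let n1 := mfrestr mA1 A1oo.
Let n2 := mfrestr mA2 A2oo.
Let kE := fun p : T1 * T2 => (k p.1 p.2)%:E.

Let int2 x : (\int[n2]_y kE (x, y) = \int[m2]_y (k x y)%:E)%E.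
Proof. by apply: integral_mfrestr => y nA; rewrite /kE k0//= => -[]. Qed.

Let int1 y : (\int[n1]_x kE (x, y) = \int[m1]_x (k x y)%:E)%E.
Proof. by apply: integral_mfrestr => x nA; rewrite /kE k0//= => -[]. Qed.

Let ik : (n1 \x n2)%E.-integrable setT kE.
Proof.
have mkE : measurable_fun setT kE by exact/measurable_EFinP.
apply/(integrable12ltyP n1 n2 mkE).
have Hoo : (\int[n2]_y (H y)%:E < +oo)%E.
  rewrite integral_mfrestr; first exact: integrable_lty.
  by move=> y /H0 ->.
apply: (@le_lt_trans _ _ (\int[n1]_x (cst (\int[n2]_y (H y)%:E) x))%E).
  apply: ge0_le_integral => //.
  - by move=> x _; apply: integral_ge0.
  - apply: (measurable_fun_fubini_tonelli_F (m2 := n2) (fun p => `|kE p|%E)) => //.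
    exact: measurableT_comp.
  - move=> x _; apply: ge0_le_integral => //.
    + have h : measurable_fun setT (fun p => `|kE p|%E) by exact: measurableT_comp.
      exact: (measurableT_comp h (pair1_measurable x)).
    + by case/integrableP: iH.
    + by move=> y _; rewrite lee_fin; exact: kH.
rewrite integral_cst//.
have H00 : (0 <= \int[n2]_y (H y)%:E)%E.
  by apply: integral_ge0 => y _; rewrite lee_fin; apply: le_trans (kH point y).
rewrite lte_mul_pinfty// ?ge0_fin_numE//.
by change (m1 (setT `&` A1) < +oo)%E; rewrite setTI.
Qed.

(** Both measures are replaced by their restrictions to sets of finite measure outside
    which k vanishes; Fubini's theorem for sigma-finite measures applies to these. *)
Lemma fubini_finite :
  (\int[m1]_x \int[m2]_y (k x y)%:E = \int[m2]_y \int[m1]_x (k x y)%:E)%E.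
Proof.
transitivity (\int[n1]_x \int[n2]_y kE (x, y))%E.
  rewrite integral_mfrestr; first by apply: eq_integral => x _; rewrite int2.
  by move=> x nA; apply: integral0_eq => y _; rewrite /kE k0//= => -[].
rewrite (Fubini ik) integral_mfrestr; first by apply: eq_integral => y _; rewrite int1.
by move=> y nA; apply: integral0_eq => x _; rewrite /kE k0//= => -[].
Qed.

Lemma integrable_fubini_finite :
  m1.-integrable setT (fun x => (\int[m2]_y (k x y)%:E)%E).
Proof.
have E : (fun x => (\int[m2]_y (k x y)%:E)%E) = fubini_F n2 kE.
  by apply/funext => x; rewrite -int2.
have /integrableP[mF Foo] := integrable_fubini_F ik.
rewrite E; apply/integrableP; split=> //.
rewrite -(@integral_mfrestr _ _ m1 A1 mA1 A1oo)// => x nA.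
rewrite /fubini_F integral0_eq ?abse0// => y _.
by rewrite /kE k0//= => -[].
Qed.

Lemma measurable_fubini_finite2 :
  measurable_fun setT (fun y => (\int[m1]_x (k x y)%:E)%E).
Proof.
by have := measurable_fubini_G ik; congr measurable_fun; apply/funext => y; exact: int1.
Qed.

End FubiniFinite.

(** * The energy of the correlation with a band-limited function *)

Section Correlation.
Context {R : realType} {G : topologicalZmodType}.
Hypotheses (hausG : hausdorff_space G) (lcG : locally_compact [set: G])
  (scG : @second_countable G).
Variable mu : {measure set (borel G) -> \bar R}.
Hypothesis haar_mu : haar_measure mu.
Variable nu : {measure set (borel (dual R G)) -> \bar R}.
Variable F : (G -> R[i]) -> (dual R G -> R[i]).
Hypothesis planF : is_plancherel_transform mu nu F.
Implicit Types f g : G -> R[i].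

Lemma L1_of_L2_finite {d} {T : measurableType d} (m : {measure set T -> \bar R})
    (A : set T) (f : T -> R[i]) :
  measurable A -> (m A < +oo)%E -> L2 m f -> (forall x, ~ A x -> f x = 0) ->
  m.-integrable setT (fun x => (normc (f x))%:E).
Proof.
move=> mA Aoo fL f0.
have iA : m.-integrable setT (fun x => (\1_A x : R)%:E).
  apply/integrableP; split.
    by apply/measurable_EFinP; exact: measurable_indic.
  under eq_integral do rewrite gee0_abs ?lee_fin//.
  by rewrite integral_indic// setIT.
have ih : m.-integrable setT (fun x => (\1_A x + sqc (f x))%:E).
  by under eq_fun do rewrite EFinD; apply: integrableD => //; exact: L2_integrable_sqc.
apply: le_integrable ih => //.
  by apply/measurable_EFinP; apply: measurable_normc; case: fL.
move=> x _; rewrite lee_fin !ger0_norm ?normc_ge0//; last first.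
  by rewrite addr_ge0// sqc_ge0.
have [Ax|nAx] := pselect (A x).
  rewrite indicE mem_set// -normc_sqr (_ : true%:R = 1 :> R)//.
  by have := sqr_ge0 (normc (f x) - 1); have := normc_ge0 (f x); nra.
rewrite f0// normc_sqrt /sqc /= expr0n /= addr0 sqrtr0 addr0.
by rewrite indicE.
Qed.

Lemma L2_indic {d} {T : measurableType d} (m : {measure set T -> \bar R})
    (A : set T) : measurable A -> (m A < +oo)%E ->
  L2 m (fun x => ((\1_A x : R)%:C)%C).
Proof.
move=> mA Aoo; split; first exact: cmeasurable_indic.
rewrite sqnorm2E (_ : (\int[m]_x _)%E = m A)//.
transitivity (m (A `&` setT)); last by rewrite setIT.
rewrite -integral_indic//; apply: eq_integral => x _.
by rewrite /sqc /= expr0n addr0 indicE; case: (_ \in _); rewrite /= ?expr1n ?expr0n.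
Qed.

(** The translation rule holds for integrable functions by a change of variables,
    and passes to L2 by truncating to an exhaustion, both sides being isometric
    in f. *)
Lemma plancherel_translate (a : G) f : L2 mu f ->
  {ae nu, forall w, F (translate a f) w = conjc (pairing a w) * F f w}.
Proof.
move=> fL.
have [U exU] := exhaustion_exists hausG lcG scG.
have [oU pU _ Ule UT] := exU.
have mU n : measurable (U n : set (borel G)) by exact: borel_open.
have Uoo n : (mu (U n) < +oo)%E by exact: haar_precompact_lty.
pose f_ n x := ((\1_(U n) x : R)%:C)%C * f x.
have f_L n : L2 mu (f_ n).
  apply: (@L2M _ _ _ _ _ _ 1) => //; first exact: (cmeasurable_indic (mU n)).
  move=> x; rewrite /sqc /= expr0n addr0 indicE.
  by case: (_ \in _); rewrite /= ?expr1n ?expr0n.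
have f_1 n : L1 mu (f_ n).
  split; first by case: (f_L n).
  have := @L1_of_L2_finite _ _ mu (U n) (f_ n) (mU n) (Uoo n) (f_L n).
  have h0 : forall x, ~ U n x -> f_ n x = 0.
    by move=> x nU; rewrite /f_ indicE memNset// mul0r.
  move=> /(_ h0) /integrable_lty; exact.
pose e w : R[i] := conjc (pairing a w).
have me : cmeasurable (e : borel (dual R G) -> R[i]).
  by apply: cmeasurable_conjc; exact: cmeasurable_pairing.
have e1 w : sqc (e w) <= 1 by rewrite sqc_conjc sqc_pairing.
pose D w := F (translate a f) w + - 1 * (e w * F f w).
have FL g : L2 mu g -> L2 nu (F g) by exact: plancherel_L2.
have FTL : L2 nu (F (translate a f)) by apply: FL; exact: L2_translate.
have eFL g : L2 mu g -> L2 nu (fun w => e w * F g w).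
  by move=> gL; apply: (@L2M _ _ _ _ _ _ 1) => //; exact: FL.
have DL : L2 nu D by apply: L2D => //; apply: L2Z; exact: eFL.
pose r n := (\int[mu]_x (sqc (- 1 * f_ n x + f x))%:E)%E.
have Dle n : (sqnorm2 nu D <= 4%:E * r n)%E.
  have TfL : L2 mu (translate a f) by exact: L2_translate.
  have TfnL : L2 mu (translate a (f_ n)) by exact: L2_translate.
  pose A w := - 1 * F (translate a (f_ n)) w + F (translate a f) w.
  pose B w := - 1 * F (f_ n) w + F f w.
  have AL : L2 nu A by apply: L2D; [apply: L2Z|]; exact: FL.
  have BL : L2 nu B by apply: L2D; [apply: L2Z|]; exact: FL.
  have eBL : L2 nu (fun w => (- 1 * e w) * B w).
    apply: (@L2M _ _ _ _ _ _ 1) => //.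
      by apply: cmeasurableM => //; exact: cmeasurable_cst.
    by move=> w; rewrite mulN1r sqcN.
  (* The two errors made by truncating f, before and after translating; their
     difference is D almost everywhere because f_ n obeys the translation rule. *)
  have DE : sqnorm2 nu D = sqnorm2 nu (fun w => A w + (- 1 * e w) * B w).
    apply: sqnorm2_ae; [by case: DL|by apply: cmeasurableD; [case: AL|case: eBL]|].
    have [_ foE _ _ _] := planF.
    have h1 := foE _ (f_1 n) (f_L n).
    have Tf1 : L1 mu (translate a (f_ n)).
      split; first by case: TfnL.
      have := @integral_translate _ _ _ haar_mu (fun x => (normc (f_ n x))%:E) a.
      move=> ->; first by case: (f_1 n).
      by apply/measurable_EFinP; apply: measurable_normc; case: (f_L n).
    have h2 := foE _ Tf1 TfnL.
    move: h1 h2; apply: ae_imp2 => w w1 w2.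
    rewrite /D /A /B w2 w1 (fourier_translate haar_mu a w (f_1 n)) -/(e w); ring.
  rewrite DE.
  have An : sqnorm2 nu A = r n.
    rewrite /A (plancherel_comb planF (-1) TfnL TfL) /r -sqnorm2E.
    apply: (@sqnorm2_translate _ _ _ haar_mu a (fun x => - 1 * f_ n x + f x)).
    apply: cmeasurableD; last by case: fL.
    by apply: cmeasurableM; [exact: cmeasurable_cst|case: (f_L n)].
  have Bn : sqnorm2 nu (fun w => (- 1 * e w) * B w) = r n.
    rewrite sqnorm2E.
    under eq_integral do rewrite mulN1r sqcM sqcN sqc_conjc sqc_pairing mul1r.
    by rewrite -sqnorm2E /B (plancherel_comb planF (-1) (f_L n) fL) /r -sqnorm2E.
  have i1 := L2_integrable_sqc AL; have i2 := L2_integrable_sqc eBL.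
  rewrite sqnorm2E; apply: (@le_trans _ _
     (\int[nu]_w (2%:E * ((sqc (A w))%:E + (sqc ((- 1 * e w) * B w))%:E)))%E).
    apply: ge0_le_integral => //.
    - by move=> w _; rewrite lee_fin sqc_ge0.
    - apply/measurable_EFinP; apply: measurable_sqc.
      by apply: cmeasurableD; [case: AL|case: eBL].
    - apply: measurable_funeM; apply: emeasurable_funD.
        by case/integrableP: i1.
      by case/integrableP: i2.
    - by move=> w _; rewrite -EFinD -EFinM lee_fin; exact: sqcD_le.
  rewrite integralZl//; last exact: integrableD.
  rewrite integralD// -!sqnorm2E An Bn.
  rewrite -{1}[r n]mul1e -{2}[r n]mul1e -ge0_muleDl ?lee_fin// muleA.
  rewrite -EFinD -EFinM lee_wpmul2r//; last by rewrite lee_fin; lra.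
  by apply: integral_ge0 => x _; rewrite lee_fin sqc_ge0.
have rcvg : r @ \oo --> 0%E.
  have -> : 0%E = (\int[mu]_x (cst 0%E : borel G -> \bar R) x)%E by rewrite integral0.
  apply: (@dominated_cvg _ _ _ mu setT measurableT _ _ (fun x => (sqc (f x))%:E)).
  - move=> n; apply/measurable_EFinP; apply: measurable_sqc.
    apply: cmeasurableD; last by case: fL.
    by apply: cmeasurableM; [exact: cmeasurable_cst|case: (f_L n)].
  - move=> x _; have [N _ UN] : (\bigcup_n U n) x by rewrite UT.
    apply: cvg_near_cst; exists N => // n /= Nn.
    rewrite /f_ indicE mem_set ?mul1r ?mulN1r ?addNr; last exact: Ule UN.
    by rewrite /sqc /= expr0n addr0.
  - by [].
  - exact: L2_integrable_sqc.
  - move=> n x _; rewrite gee0_abs ?lee_fin ?sqc_ge0// /f_ indicE.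
    case: (_ \in _); rewrite /= ?mul1r ?mul0r ?mulr0 ?add0r//.
    by rewrite mulN1r addNr /sqc /= expr0n addr0 addr_ge0// sqr_ge0.
have D0 : sqnorm2 nu D = 0%E.
  apply/eqP; rewrite eq_le sqnorm2_ge0 andbT.
  have c4 : (fun n => 4%:E * r n)%E @ \oo --> (4%:E * 0)%E by exact: cvgeZl.
  rewrite mule0 in c4.
  rewrite -(cvg_lim (@ereal_hausdorff R) c4); apply: lime_ge.
    by apply/cvg_ex; exists 0%E.
  by apply: nearW.
have mD : cmeasurable (D : borel (dual R G) -> R[i]) by case: DL.
have := sqnorm2_eq0 mD D0; apply: ae_imp => w.
by rewrite /D mulN1r => /subr0_eq.
Qed.

Lemma conjc_cintegral {d} {T : measurableType d} (m : {measure set T -> \bar R})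
    (f : T -> R[i]) : m.-integrable setT (fun x => (Im (f x))%:E) ->
  conjc (cintegral m f) = cintegral m (fun x => conjc (f x)).
Proof.
move=> ii; apply: complex_ext => /=.
  by apply: eq_Rintegral => x _; rewrite Re_conjc.
rewrite -[LHS]mulN1r -RintegralZl//.
by apply: eq_Rintegral => x _; rewrite Im_conjc mulN1r.
Qed.

Lemma measurable_pairing :
  measurable_fun setT (fun p : borel G * borel (dual R G) => Re (pairing p.1 p.2)) /\
  measurable_fun setT (fun p : borel G * borel (dual R G) => Im (pairing p.1 p.2)).
Proof.
split.
  apply: (@measurable_caratheodory R G _ (borel (dual R G)) (fun x w => Re (pairing x w)) scG).
    move=> w x; apply: (@continuous_comp _ _ _ (fun x => pairing x w : R[i]^o)).
      exact: continuous_pairingl.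
    exact: continuous_Re.
  by move=> x; case: (@cmeasurable_pairing R G x).
apply: (@measurable_caratheodory R G _ (borel (dual R G)) (fun x w => Im (pairing x w)) scG).
  move=> w x; apply: (@continuous_comp _ _ _ (fun x => pairing x w : R[i]^o)).
    exact: continuous_pairingl.
  exact: continuous_Im.
by move=> x; case: (@cmeasurable_pairing R G x).
Qed.

Section InverseTransform.
Variables (Z : set (dual R G)) (h : dual R G -> R[i]) (u : G -> R[i]).
Hypotheses (mZ : measurable (Z : set (borel (dual R G)))) (Zoo : (nu Z < +oo)%E).
Hypotheses (hL : L2 nu h) (h0 : forall w, ~ Z w -> h w = 0).
Hypotheses (uL : L2 mu u) (Fu : {ae nu, forall w, F u w = h w}).

Definition inverse_transform (x : G) : R[i] :=
  cintegral nu (fun w => h w * pairing x w).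
Local Notation psi := inverse_transform.

Variables (c : R[i]) (A : set G).
Hypotheses (mA : measurable (A : set (borel G))) (Aoo : (mu A < +oo)%E).

Let kk x w : R := \1_A x * Re (c * (h w * pairing x w)).
Let H w : R := normc (c * h w).

Let mch : cmeasurable ((fun w => c * h w) : borel (dual R G) -> R[i]).
Proof. by apply: cmeasurableM; [exact: cmeasurable_cst|case: hL]. Qed.

Let mkk : measurable_fun setT (fun p : borel G * borel (dual R G) => kk p.1 p.2).
Proof.
have [mr mi] := measurable_pairing; have [cr ci] := mch.
apply: (eq_measurable_fun (fun p : borel G * borel (dual R G) => \1_A p.1 *
    (Re (c * h p.2) * Re (pairing p.1 p.2) - Im (c * h p.2) * Im (pairing p.1 p.2)))).
  by move=> p _; rewrite /kk mulrA [in RHS]ReM.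
apply: measurable_funM.
  by apply: measurableT_comp => //; exact: measurable_indic.
apply: measurable_funB; apply: measurable_funM => //.
  exact: (measurableT_comp cr measurable_snd).
exact: (measurableT_comp ci measurable_snd).
Qed.

Let kk0 x w : ~ (A x /\ Z w) -> kk x w = 0.
Proof.
move=> nAZ; rewrite /kk; have [Ax|nAx] := pselect (A x); last first.
  by rewrite indicE memNset// mul0r.
by rewrite h0 ?mul0r ?mulr0 ?mulr0//= => Zw; apply: nAZ.
Qed.

Let H0 w : ~ Z w -> H w = 0.
Proof. by move=> /h0 hw; rewrite /H hw mulr0 normc_sqrt /sqc /= expr0n addr0 sqrtr0. Qed.

Let ihc : nu.-integrable setT (fun w : borel (dual R G) => (normc (c * h w))%:E).
Proof.
apply: (L1_of_L2_finite mZ Zoo) => [|w /h0 ->]; last by rewrite mulr0.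
exact: L2Z.
Qed.

Let kkH x w : `|kk x w| <= H w.
Proof.
rewrite /kk /H normrM -[leRHS]mul1r ler_pM//.
  by rewrite indicE; case: (_ \in _); rewrite /= ?normr1 ?normr0.
rewrite mulrA; apply: le_trans (abs_Re_le _) _.
by rewrite normcM [X in _ * X]normc_sqrt sqc_pairing sqrtr1 mulr1.
Qed.

Let int_kk_w x : (\int[nu]_w (kk x w)%:E = (\1_A x * Re (c * psi x))%:E)%E.
Proof.
have mhp : cmeasurable ((fun w => h w * pairing x w) : borel (dual R G) -> R[i]).
  by apply: cmeasurableM; [case: hL|exact: cmeasurable_pairing].
have hpL : L2 nu (fun w => h w * pairing x w).
  apply: (@L2Mr _ _ _ _ _ _ 1) => //; first exact: cmeasurable_pairing.
  by move=> w; rewrite sqc_pairing.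
have ih : nu.-integrable setT (fun w : borel (dual R G) => (normc (h w * pairing x w))%:E).
  by apply: (L1_of_L2_finite mZ Zoo) => // w /h0 ->; rewrite mul0r.
have [mr mi] := mhp.
have ir : nu.-integrable setT (fun w : borel (dual R G) => (Re (h w * pairing x w))%:E).
  apply: le_integrable ih => //; first exact/measurable_EFinP.
  by move=> w _; rewrite lee_fin [leRHS]ger0_norm ?normc_ge0//; exact: abs_Re_le.
have ii : nu.-integrable setT (fun w : borel (dual R G) => (Im (h w * pairing x w))%:E).
  apply: le_integrable ih => //; first exact/measurable_EFinP.
  by move=> w _; rewrite lee_fin [leRHS]ger0_norm ?normc_ge0//; exact: abs_Im_le.
rewrite /psi -cintegralZ// /cintegral /= /Rintegral.
have ich : nu.-integrable setT
    (fun w : borel (dual R G) => (Re (c * (h w * pairing x w)))%:E).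
  have [cr ci] := cmeasurableM mch (cmeasurable_pairing x).
  apply: le_integrable ihc => //.
    apply/measurable_EFinP; apply: eq_measurable_fun cr => w _ /=.
    by rewrite mulrA.
  move=> w _; rewrite lee_fin [leRHS]ger0_norm ?normc_ge0// mulrA.
  apply: le_trans (abs_Re_le _) _.
  by rewrite normcM [X in _ * X]normc_sqrt sqc_pairing sqrtr1 mulr1.
rewrite EFinM fineK; last exact: integrable_fin_num.
rewrite -integralZl//.
Qed.

Let int_kk_x : {ae nu, forall w,
  (Re (c * (F u w * conjc (F (fun x => ((\1_A x : R)%:C)%C) w))))%:E =
  (\int[mu]_x (kk x w)%:E)%E}.
Proof.
have AL : L2 mu (fun x : borel G => ((\1_A x : R)%:C)%C) by exact: L2_indic.
have A0 x : ~ A x -> ((\1_A x : R)%:C)%C = 0 :> R[i].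
  by move=> nA; rewrite indicE memNset.
have A1 : L1 mu (fun x : borel G => ((\1_A x : R)%:C)%C).
  split; first by case: AL.
  by have /integrable_lty := L1_of_L2_finite mA Aoo AL A0; exact.
have [_ foE _ _ _] := planF.
have := foE _ A1 AL; move: Fu; apply: ae_imp2 => w -> ->.
have mAp : cmeasurable ((fun x => ((\1_A x : R)%:C)%C * conjc (pairing x w)) : borel G -> R[i]).
  by apply: cmeasurableM; [case: AL|apply: cmeasurable_conjc; exact: cmeasurable_pairingl].
have ApL : L2 mu (fun x : borel G => ((\1_A x : R)%:C)%C * conjc (pairing x w)).
  apply: (@L2Mr _ _ _ _ _ _ 1) => //.
    by apply: cmeasurable_conjc; exact: cmeasurable_pairingl.
  by move=> x; rewrite sqc_conjc sqc_pairing.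
have ApL1 : L1 mu (fun x : borel G => ((\1_A x : R)%:C)%C * conjc (pairing x w)).
  split=> //.
  have Ap0 x : ~ A x -> ((\1_A x : R)%:C)%C * conjc (pairing x w) = 0.
    by move=> /A0 ->; rewrite mul0r.
  by have /integrable_lty := L1_of_L2_finite mA Aoo ApL Ap0; exact.
have [ir ii] := L1_integrable ApL1.
rewrite /fourier conjc_cintegral//.
rewrite mulrA -cintegralZ; last 2 first.
- by apply: eq_integrable ir => // x _; rewrite Re_conjc.
- by apply: eq_integrable (integrableN ii) => // x _; rewrite Im_conjc.
rewrite [Re _]/(\int[mu]_x _) /Rintegral.
have E x : Re (c * h w * conjc (((\1_A x : R)%:C)%C * conjc (pairing x w))) = kk x w.
  by rewrite /kk rmorphM /= conjcK !complex_partsE /=; ring.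
under eq_integral do rewrite E.
rewrite fineK//; apply: integrable_fin_num => //.
have iE : mu.-integrable setT (fun x : borel G =>
    (Re (c * h w) * Re (((\1_A x : R)%:C)%C * conjc (pairing x w)) +
     Im (c * h w) * Im (((\1_A x : R)%:C)%C * conjc (pairing x w)))%:E).
  exact: integrable_comb.
apply: eq_integrable iE => // x _; congr (_%:E).
by rewrite -E [Re (c * h w * _)]ReM Re_conjc Im_conjc mulrN opprK.
Qed.

(** The integral of u over A is <u, 1_A> = <F u, F 1_A> = <h, F 1_A>, and F 1_A is
    the integral of a conjugate character over A; Fubini moves the integral over A
    outside. The factor c serves to treat real and imaginary parts at once. *)
Lemma inverse_transform_test :
  [/\ (\int[mu]_(x in (A : set (borel G))) (Re (c * u x))%:E =
       \int[mu]_(x in (A : set (borel G))) (Re (c * psi x))%:E)%E,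
      mu.-integrable (A : set (borel G)) (fun x => (Re (c * u x))%:E)
    & measurable_fun (A : set (borel G)) (fun x => Re (c * psi x))].
Proof.
have AL : L2 mu (fun x : borel G => ((\1_A x : R)%:C)%C) by exact: L2_indic.
have [ir ii] := L2_integrable_prod uL AL.
have vE x : Re (c * (u x * conjc ((\1_A x : R)%:C)%C)) = \1_A x * Re (c * u x).
  by rewrite mulrA ReM Re_conjc Im_conjc /= oppr0 mulr0 subr0 mulrC.
have iv : mu.-integrable setT (fun x : borel G => (\1_A x * Re (c * u x))%:E).
  apply: eq_integrable (integrable_comb (Re c) (- Im c) ir ii) => // x _.
  by rewrite -vE [in RHS]ReM mulNr.
have ip : mu.-integrable setT (fun x : borel G => (\1_A x * Re (c * psi x))%:E).
  by apply: eq_integrable (integrable_fubini_finite mA Aoo mZ Zoo mkk kk0 H0 ihc kkH).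
have vp : (\int[mu]_x (\1_A x * Re (c * u x))%:E =
           \int[mu]_x (\1_A x * Re (c * psi x))%:E)%E.
  rewrite -[LHS]fineK; last exact: integrable_fin_num.
  rewrite -[RHS]fineK; last exact: integrable_fin_num.
  congr (_%:E); transitivity (Re (c * inner mu u (fun x => ((\1_A x : R)%:C)%C))).
    rewrite /inner -cintegralZ// [RHS]/(\int[mu]_x _) /Rintegral; congr fine.
    by apply: eq_integral => x _; rewrite vE.
  have FuL := plancherel_L2 planF uL; have FAL := plancherel_L2 planF AL.
  rewrite -(parseval planF uL AL) /inner.
  have [jr ji] := L2_integrable_prod FuL FAL.
  rewrite -cintegralZ// [LHS]/(\int[nu]_x _) /Rintegral; congr fine.
  transitivity (\int[nu]_w \int[mu]_x (kk x w)%:E)%E.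
    apply: ae_eq_integral => //.
    - apply/measurable_EFinP.
      have [] // : cmeasurable ((fun w => c * (F u w *
          conjc (F (fun x => ((\1_A x : R)%:C)%C) w))) : borel (dual R G) -> R[i]).
      apply: cmeasurableM; first exact: cmeasurable_cst.
      by apply: cmeasurableM; [case: FuL|apply: cmeasurable_conjc; case: FAL].
    - exact: (measurable_fubini_finite2 mA Aoo mZ Zoo mkk kk0 H0 ihc kkH).
    - by move: int_kk_x; apply: ae_imp => w + _; exact.
  rewrite -(fubini_finite mA Aoo mZ Zoo mkk kk0 H0 ihc kkH).
  by apply: eq_integral => x _; rewrite int_kk_w.
have resE (r : G -> R) : (fun x : borel G => (r x)%:E) \_ A = fun x => (\1_A x * r x)%:E.
  apply/funext => x; rewrite patchE indicE.
  by case: ifPn => _; rewrite ?mul1r ?mul0r.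
split.
- by rewrite integral_mkcond [RHS]integral_mkcond !resE.
- by rewrite integrable_mkcond// resE.
- by apply/measurable_EFinP/measurable_restrictT => //; rewrite resE; case/integrableP: ip.
Qed.

End InverseTransform.

Section CorrelationEnergy.
Variables (Z : set (dual R G)) (f : G -> R[i]).
Hypotheses (mZ : measurable (Z : set (borel (dual R G)))) (Zoo : (nu Z < +oo)%E).
Hypotheses (fL : L2 mu f) (Ff : {ae nu, forall w, F f w = ((\1_Z w : R)%:C)%C}).

(** By Parseval and the translation rule, translating f by x multiplies the
    indicator of Z by a character evaluated at x. *)
Lemma correlationE g x : L2 mu g ->
  inner mu g (translate x f) =
  inverse_transform (fun w => ((\1_Z w : R)%:C)%C * F g w) x.
Proof.
move=> gL; have TfL : L2 mu (translate x f) by exact: L2_translate.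
have FgL := plancherel_L2 planF gL.
rewrite -(parseval planF gL TfL).
have mp : cmeasurable ((fun w => conjc (pairing x w) * ((\1_Z w : R)%:C)%C)
    : borel (dual R G) -> R[i]).
  apply: cmeasurableM; last exact: cmeasurable_indic.
  by apply: cmeasurable_conjc; exact: cmeasurable_pairing.
rewrite (@inner_ae R _ (borel (dual R G)) nu (F g) (F g) (F (translate x f))
  (fun w => conjc (pairing x w) * ((\1_Z w : R)%:C)%C)) //.
- rewrite /inner /inverse_transform; congr cintegral; apply/funext => w.
  by apply: complex_ext; rewrite !complex_partsE /=; ring.
- by case: FgL.
- by case: FgL.
- by case: (plancherel_L2 planF TfL).
- exact: aeW.
- have := plancherel_translate x fL; move: Ff; apply: ae_imp2 => w Fw ->.
  by rewrite Fw.
Qed.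

(** The function u with transform 1_Z F g has the right norm by Plancherel, and it
    coincides almost everywhere with the correlation because both have the same
    integral over every measurable subset of each member of an exhaustion. *)
Lemma correlation_energy g : L2 mu g ->
  measurable_fun setT ((fun x => sqc (inner mu (translate x f) g)) : borel G -> R) /\
  (\int[mu]_x (sqc (inner mu (translate x f) g))%:E =
   \int[nu]_w (\1_Z w * sqc (F g w))%:E)%E.
Proof.
move=> gL; have FgL := plancherel_L2 planF gL.
pose h w : R[i] := ((\1_Z w : R)%:C)%C * F g w.
have hL : L2 nu h.
  apply: (@L2M _ _ _ _ _ _ 1) => //; first exact: cmeasurable_indic.
  move=> w; rewrite /sqc /= expr0n addr0 indicE.
  by case: (_ \in _); rewrite /= ?expr1n ?expr0n.
have h0 w : ~ Z w -> h w = 0 by move=> nZ; rewrite /h indicE memNset// mul0r.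
have [_ _ _ _ surj] := planF; have [u uL Fu] := surj h hL.
have [U exU] := exhaustion_exists hausG lcG scG.
have [oU pU _ _ UT] := exU.
have mU n : measurable (U n : set (borel G)) by exact: borel_open.
have Uoo n : (mu (U n) < +oo)%E by exact: haar_precompact_lty.
have test c A (mA : measurable (A : set (borel G))) (Aoo : (mu A < +oo)%E) :=
  inverse_transform_test mZ Zoo hL h0 uL Fu c mA Aoo.
have mpsi c : measurable_fun setT ((fun x => Re (c * inverse_transform h x)) : borel G -> R).
  rewrite -UT; apply/measurable_fun_bigcup => // n.
  by case: (test c (U n) (mU n) (Uoo n)).
have upsi c : {ae mu, forall x, Re (c * u x) = Re (c * inverse_transform h x)}.
  have : {ae mu, forall x, forall n, U n x -> Re (c * u x) = Re (c * inverse_transform h x)}.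
    apply: ae_foralln => n.
    have [_ iu mp] := test c (U n) (mU n) (Uoo n).
    have mpE : measurable_fun (U n : set (borel G))
        (fun x => (Re (c * inverse_transform h x))%:E) by exact/measurable_EFinP.
    have : ae_eq mu (U n : set (borel G)) (fun x => (Re (c * u x))%:E)
        (fun x => (Re (c * inverse_transform h x))%:E).
      apply: (integral_ae_eq (mU n) iu mpE) => B BU mB.
      have Boo : (mu B < +oo)%E.
        by apply: le_lt_trans (Uoo n); apply: le_measure; rewrite ?inE.
      by case: (test c B mB Boo).
    by apply: ae_imp => x h1 Ux; case: (h1 Ux).
  apply: ae_imp => x h1; have [n _ Ux] : (\bigcup_n U n) x by rewrite UT.
  exact: h1 n Ux.
have eqE x : sqc (inner mu (translate x f) g) = sqc (inverse_transform h x).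
  by rewrite (innerC gL (L2_translate haar_mu x fL)) sqc_conjc (correlationE _ gL).
have mc : cmeasurable (inverse_transform h : borel G -> R[i]).
  split.
    by apply: eq_measurable_fun (mpsi 1) => x _; rewrite mul1r.
  apply: eq_measurable_fun (mpsi (- 'i%C)) => x _.
  by rewrite ReM /= oppr0 mul0r sub0r mulN1r opprK.
split.
  by apply: eq_measurable_fun (measurable_sqc mc) => x _; rewrite eqE.
under eq_integral do rewrite eqE.
rewrite -sqnorm2E -(@sqnorm2_ae _ _ _ mu u (inverse_transform h)) //; last 2 first.
- by case: uL.
- move: (upsi 1) (upsi (- 'i%C)); apply: ae_imp2 => x.
  rewrite !mul1r => eR eI; apply: complex_ext => //.
  by move: eI; rewrite !ReM /= !oppr0 !mul0r !sub0r !mulN1r !opprK.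
rewrite -(plancherel_sqnorm2 planF uL) (@sqnorm2_ae _ _ _ nu (F u) h) //; last 2 first.
- by case: (plancherel_L2 planF uL).
- by case: hL.
rewrite sqnorm2E; apply: eq_integral => w _; rewrite /h sqcM; congr ((_ * _)%:E).
rewrite /sqc /= expr0n addr0 indicE.
by case: (_ \in _); rewrite /= ?expr1n ?expr0n.
Qed.

End CorrelationEnergy.

End Correlation.

(** * Averaging the frame inequality *)

Section Averaging.
Context {R : realType} {G : topologicalZmodType}.
Hypotheses (hausG : hausdorff_space G) (lcG : locally_compact [set: G])
  (scG : @second_countable G).
Variable mu : {measure set (borel G) -> \bar R}.
Hypothesis haar_mu : haar_measure mu.
Variable nu : {measure set (borel (dual R G)) -> \bar R}.
Hypothesis haar_nu : haar_measure nu.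
Variable F : (G -> R[i]) -> (dual R G -> R[i]).
Hypothesis planF : is_plancherel_transform mu nu F.
Variable E : set (dual R G).
Variables (J : countType) (Gamma : J -> zmodClosed G).
Hypothesis latticeGamma : forall j, lattice (Gamma j).
Variable g : J -> G -> R[i].
Hypothesis gL2 : forall j, L2 mu (g j).
Variables (A B : R).
Hypothesis frame_g : is_frame mu [set p : J * G | p.2 \in Gamma p.1]
  (fun p => translate p.2 (g p.1)) A B.
Hypothesis ucp_g : ucp1 mu nu F E Gamma g.

Let wj f j x := wfunj mu Gamma g f j x.
Let w f x := wfun mu Gamma g f x.

Lemma wfunjE f j x : cmeasurable (f : borel G -> R[i]) ->
  wj f j x = \esum_(gamma in [set` Gamma j])
               (sqc (inner mu (translate (x - gamma) f) (g j)))%:E.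
Proof.
move=> mf; apply: eq_esum => gamma _; rewrite normc_sqr; congr ((sqc _)%:E).
rewrite -(inner_translate haar_mu gamma (cmeasurable_translate (x - gamma) mf));
  last by case: (gL2 j).
congr (inner mu _ _); apply/funext => y; rewrite /translate; congr f.
by rewrite opprB addrA subrK.
Qed.

Lemma wfunj_ge0 f j x : (0 <= wj f j x)%E.
Proof. by apply: esum_ge0 => gamma _; rewrite lee_fin sqr_ge0. Qed.

(** The sum over pairs in the frame inequality for T_x f is the iterated sum that
    defines w_f. *)
Lemma frame_lower_wfun f x : L2 mu f -> (A%:E * sqnorm2 mu f <= w f x)%E.
Proof.
move=> fL; have [_ _ fr] := frame_g.
have /andP[+ _] := fr _ (L2_translate haar_mu x fL).
rewrite (sqnorm2_translate haar_mu x); last by case: fL.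
rewrite /w /wfun /wfunj esum_esum; last by move=> j gamma; rewrite lee_fin sqr_ge0.
rewrite (_ : [set p | _] = [set: J] `*`` (fun j => [set` Gamma j]))//.
by apply/seteqP; split=> -[j gamma] //= [].
Qed.

(** Once the tile D of the lattice fits into U n, the unfolding estimate compares
    mu(H + U n) with mu D, that is (1 + 1/(n+1)) mu H with the covolume. *)
Lemma average_wfunj (U : nat -> set G) (k : nat -> nat) f j I :
  exhaustion U ->
  (forall n, (0 < k n)%N /\
    (mu (multset (U n) (k n).+1) <= (1 + n.+1%:R^-1)%:E * mu (multset (U n) (k n)))%E) ->
  L2 mu f ->
  measurable_fun setT ((fun x => sqc (inner mu (translate x f) (g j))) : borel G -> R) ->
  (\int[mu]_x (sqc (inner mu (translate x f) (g j)))%:E)%E = I%:E ->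
  \forall n \near \oo,
    (\int[mu]_(x in (multset (U n) (k n) : set (borel G))) wj f j x <=
     ((1 + n.+1%:R^-1) * ((covol mu (Gamma j))^-1 * I))%:E * mu (multset (U n) (k n)))%E.
Proof.
move=> exU kP fL mphi phiI; have [oU pU U0 Ule UT] := exU.
have [D [mD pD packD c0 cD]] := covol_bounds hausG lcG scG haar_mu (latticeGamma j).
have [N DN] := exhaustion_absorbs hausG exU pD.
exists N => // n /= Nn; have [k0 kn] := kP n.
set H := multset (U n) (k n).
have mH : measurable (H : set (borel G)) by exact: measurable_multset.
have mf : cmeasurable (f : borel G -> R[i]) by case: fL.
have DU : D `<=` U n by move=> x /DN; exact: Ule.
have I0 : 0 <= I.
  by rewrite -lee_fin -phiI; apply: integral_ge0 => x _; rewrite lee_fin sqc_ge0.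
have := periodized_average hausG lcG scG haar_mu (latticeGamma j) mD pD packD DU (oU n) k0
  mphi (fun x => sqc_ge0 _).
rewrite phiI -/H (_ : (\int[mu]_(x in _) _)%E =
  (\int[mu]_(x in (H : set (borel G))) wj f j x)%E); last first.
  by apply: eq_integral => x _; rewrite wfunjE.
set V := (\int[mu]_(x in _) _)%E => h.
have V0 : (0 <= V)%E by apply: integral_ge0 => x _; exact: wfunj_ge0.
have h1 : ((covol mu (Gamma j))%:E * V <= ((1 + n.+1%:R^-1) * I)%:E * mu H)%E.
  apply: le_trans (lee_wpmul2r V0 cD) _; apply: le_trans h _.
  by rewrite EFinM -muleA [X in (_ <= _ * X)%E]muleC muleA lee_wpmul2r// lee_fin.
rewrite mulrCA EFinM -muleA -(@lee_pmul2l _ (covol mu (Gamma j))%:E)//.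
rewrite muleA -EFinM mulfV ?gt_eqF// mul1e.
exact: h1.
Qed.

(** The frame inequality is tested on the function f with transform 1_Z: the mean of
    w_f is at least A nu(Z), and up to epsilon it is the sum of finitely many means
    of the w_j, each bounded by the integral of |F g_j|^2 / covol over Z. *)
Lemma mean_inequality (Z K : set (dual R G)) :
  measurable (Z : set (borel (dual R G))) -> compact K -> K `<=` ~` E -> Z `<=` K ->
  (A%:E * nu Z <= \int[nu]_(o in (Z : set (borel (dual R G))))
    (\esum_(j in [set: J])
        ((covol mu (Gamma j))^-1 * normc (F (g j) o) ^+ 2)%:E))%E.
Proof.
move=> mZ cK KE ZK.
have Zoo : (nu Z < +oo)%E.
  have [_ + _] := haar_nu => /(_ K cK); apply: le_lt_trans.
  apply: le_measure; rewrite ?inE//; apply: borel_compact => //.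
  exact: hausdorff_dual.
have ZL : L2 nu (fun o : borel (dual R G) => ((\1_Z o : R)%:C)%C) by exact: L2_indic.
have [_ _ _ _ surj] := planF; have [f fL Ff] := surj _ ZL.
have mf : cmeasurable (f : borel G -> R[i]) by case: fL.
have blind : blind_class mu nu F E f.
  split=> //.
    split; first by case: (plancherel_L2 planF fL).
    exists 1; move: Ff; apply: ae_imp => o ->.
    rewrite normc_sqrt /sqc /= expr0n addr0 sqrtr_sqr indicE.
    by case: (_ \in _); rewrite /= ?normr1 ?normr0.
  exists K; split=> //; move: Ff; apply: ae_imp => o ->.
  rewrite !indicE; have [/set_mem Zo|] := boolP (o \in Z); last by rewrite mul0r.
  by rewrite mem_set ?mulr1//; exact: ZK.
have sqf : sqnorm2 mu f = nu Z.
  rewrite -(plancherel_sqnorm2 planF fL) (@sqnorm2_ae _ _ _ nu _ _ _ _ Ff); last 2 first.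
  - by case: (plancherel_L2 planF fL).
  - by case: ZL.
  rewrite sqnorm2E; transitivity (nu (Z `&` setT)); last by rewrite setIT.
  rewrite -integral_indic//; apply: eq_integral => o _.
  by rewrite /sqc /= expr0n addr0 indicE; case: (_ \in _); rewrite /= ?expr1n ?expr0n.
have [U exU] := exhaustion_exists hausG lcG scG.
have [k kP] := folner_index hausG scG haar_mu exU.
have Hav := multset_averaging hausG haar_mu exU kP.
have [oU pU U0 Ule UT] := exU.
pose H n := multset (U n) (k n).
have mH n : measurable (H n : set (borel G)).
  by apply: measurable_multset => //; case: (kP n).
have Hoo n : (mu (H n) < +oo)%E.
  by apply: (haar_precompact_lty hausG haar_mu (mH n)); exact: precompact_multset.
have Hfin n : mu (H n) \is a fin_num by rewrite ge0_fin_numE.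
have H0 n : (0 < mu (H n))%E.
  apply: haar_nbhs0_gt0 => //; first by apply: open_multset => //; case: (kP n).
  by apply: sub_multset => //; case: (kP n).
have corr j := correlation_energy hausG lcG scG haar_mu planF mZ Zoo fL Ff (gL2 j).
have mphi j := (corr j).1.
pose I j := fine (\int[nu]_o (\1_Z o * sqc (F (g j) o))%:E)%E.
have mFg j : measurable_fun setT ((fun o => sqc (F (g j) o)) : borel (dual R G) -> R).
  by apply: measurable_sqc; case: (plancherel_L2 planF (gL2 j)).
have mZFg j : measurable_fun setT ((fun o => \1_Z o * sqc (F (g j) o)) : borel (dual R G) -> R).
  by apply: measurable_funM => //; exact: measurable_indic.
have phiI j : (\int[mu]_x (sqc (inner mu (translate x f) (g j)))%:E)%E = (I j)%:E.
  rewrite (corr j).2 fineK// ge0_fin_numE; last first.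
    by apply: integral_ge0 => o _; rewrite lee_fin mulr_ge0 ?sqc_ge0.
  apply: le_lt_trans (integrable_lty measurableT
    (L2_integrable_sqc (plancherel_L2 planF (gL2 j)))).
  apply: ge0_le_integral => //.
  - by move=> o _; rewrite lee_fin mulr_ge0 ?sqc_ge0.
  - exact/measurable_EFinP.
  - exact/measurable_EFinP.
  - move=> o _; rewrite lee_fin indicE; case: (_ \in _); rewrite /= ?mul1r// mul0r.
    exact: sqc_ge0.
have mwj j : measurable_fun setT (fun x : borel G => wj f j x).
  apply: (eq_measurable_fun (fun x : borel G => \esum_(gamma in [set` Gamma j])
      (sqc (inner mu (translate (x - gamma) f) (g j)))%:E)).
    by move=> x _; rewrite wfunjE.
  apply: measurable_esum; first exact: (lattice_countable lcG scG (latticeGamma j)).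
    by move=> gamma x; rewrite lee_fin sqc_ge0.
  move=> gamma _; apply/measurable_EFinP.
  exact: (measurableT_comp (mphi j) (measurable_subl gamma)).
have mw : measurable_fun setT (fun x : borel G => w f x).
  apply: measurable_esum => //; first exact: countableP.
  by move=> j x; exact: wfunj_ge0.
(* The bound M comes from almost periodicity; it makes the integrals of w_f over the
   sets H n finite, so that the real-valued means are not truncated to 0. *)
have [wfin [_ [M wM] _] ucp] := ucp_g blind.
apply/lee_addgt0Pr => eps e0.
have [J' J'P] := ucp eps e0.
have [m mean mlt] := J'P J' (fsubset_refl J').
pose s x := (\sum_(j <- J') wj f j x)%E.
have s0 x : (0 <= s x)%E by apply: sume_ge0 => j _; exact: wfunj_ge0.
have sw x : (s x <= w f x)%E.
  apply: esum_ge; exists [set` J']; first by split=> //; exact: finite_fset.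
  by rewrite fsbig_finite ?set_fsetK//; exact: finite_fset.
have sfin x : s x \is a fin_num.
  by rewrite ge0_fin_numE//; apply: le_lt_trans (sw x) _; rewrite ltey_eq wfin.
pose v x := fine `|w f x - s x|%E.
have vE x : (v x)%:E = (w f x - s x)%E.
  rewrite /v gee0_abs; last by rewrite sube_ge0 ?sfin// sw.
  by rewrite fineK// fin_numB wfin sfin.
have v0 x : 0 <= v x by exact: fine_ge0.
have ms : measurable_fun setT (fun x : borel G => s x).
  by apply: emeasurable_sum => j; exact: mwj.
have mv : measurable_fun setT (fun x : borel G => (v x)%:E).
  apply: (eq_measurable_fun (fun x : borel G => (w f x - s x)%E)).
    by move=> x _; rewrite vE.
  exact: emeasurable_funB.
have vM x : v x <= M.
  apply: le_trans (wM x); apply: le_trans (ler_norm _).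
  by rewrite -lee_fin vE fineK// leeBlDr// leeDl.
pose sig := \sum_(j <- J') ((covol mu (Gamma j))^-1 * I j).
pose q n := (fine (mu (H n)))^-1 * (\int[mu]_(x in (H n : set (borel G))) v x).
have key : \forall n \near \oo, A * fine (nu Z) <= q n + (1 + n.+1%:R^-1) * sig.
  have allj : \forall n \near \oo, forall j, j \in J' ->
    (\int[mu]_(x in (H n : set (borel G))) wj f j x <=
     ((1 + n.+1%:R^-1) * ((covol mu (Gamma j))^-1 * I j))%:E * mu (H n))%E.
    have /choice[N NP] : forall j, exists N, forall n, (N <= n)%N ->
      (\int[mu]_(x in (H n : set (borel G))) wj f j x <=
      ((1 + n.+1%:R^-1) * ((covol mu (Gamma j))^-1 * I j))%:E * mu (H n))%E.
      move=> j; have [N _ NP] := average_wfunj exU kP fL (mphi j) (phiI j).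
      by exists N.
    exists (\max_(j <- J') N j) => // n /= nN j jJ; apply: NP.
    by apply: leq_trans nN; apply: leq_bigmax_seq.
  move: allj; apply: filterS => n hn.
  have ivfin : (\int[mu]_(x in (H n : set (borel G))) (v x)%:E)%E \is a fin_num.
    rewrite ge0_fin_numE; last by apply: integral_ge0 => x _; rewrite lee_fin.
    apply: (@le_lt_trans _ _ (\int[mu]_(x in (H n : set (borel G))) (cst M%:E) x)%E).
      apply: ge0_le_integral => //.
      - by move=> x _; rewrite lee_fin.
      - exact: measurable_funTS.
      - by move=> x _; rewrite lee_fin.
    by rewrite integral_cst// lte_mul_pinfty// lee_fin; exact: le_trans (v0 0) (vM 0).
  have h1 : ((A * fine (nu Z))%:E * mu (H n) <=
     \int[mu]_(x in (H n : set (borel G))) (v x)%:E +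
     ((1 + n.+1%:R^-1) * sig)%:E * mu (H n))%E.
    apply: (@le_trans _ _ (\int[mu]_(x in (H n : set (borel G))) w f x)%E).
      rewrite -integral_cst//; apply: ge0_le_integral => //.
      - move=> x _; rewrite /= lee_fin mulr_ge0 ?fine_ge0//.
        by have [/ltW] := frame_g.
      - exact: measurable_funTS.
      - move=> x _; rewrite /= EFinM fineK ?ge0_fin_numE// -sqf.
        exact: frame_lower_wfun.
    rewrite (_ : (\int[mu]_(x in _) _)%E =
      (\int[mu]_(x in (H n : set (borel G))) ((v x)%:E + s x))%E); last first.
      by apply: eq_integral => x _; rewrite vE subeK.
    rewrite ge0_integralD//; [|by move=> x _; rewrite lee_fin|exact: measurable_funTS
      |exact: measurable_funTS].
    rewrite leeD2l// /s ge0_integral_sum//; last 2 first.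
    - by move=> j; exact: measurable_funTS.
    - by move=> j x _; exact: wfunj_ge0.
    rewrite /sig mulr_sumr -(fineK (Hfin n)) -EFinM mulr_suml -sumEFin.
    rewrite big_seq [leRHS]big_seq; apply: lee_sum => j jJ.
    by rewrite EFinM fineK//; exact: hn.
  have Hn0 : 0 < fine (mu (H n)) by apply: fine_gt0; rewrite H0 Hoo.
  rewrite /q /Rintegral -(ler_pM2r Hn0) mulrDl [X in _ <= X + _]mulrAC.
  rewrite mulVf ?gt_eqF// mul1r.
  rewrite -lee_fin EFinD !EFinM (fineK ivfin) (fineK (Hfin n)) -!EFinM.
  exact: h1.
have qm : q @ \oo --> m by exact: mean Hav.
have Am : A * fine (nu Z) <= m + sig.
  apply: (ler_cvg_to _ _ key); first exact: cvg_cst.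
  have h1 : (fun n : nat => 1 + n.+1%:R^-1 : R) @ \oo --> (1 + 0 : R).
    by apply: cvgD; [exact: cvg_cst|exact: cvg_harmonic].
  have -> : m + sig = m + (1 + 0) * sig by rewrite addr0 mul1r.
  by apply: cvgD => //; apply: cvgM => //; exact: cvg_cst.
have sigS : (sig%:E <= \int[nu]_(o in (Z : set (borel (dual R G))))
    (\esum_(j in [set: J])
        ((covol mu (Gamma j))^-1 * normc (F (g j) o) ^+ 2)%:E))%E.
  have cov0 j : 0 <= (covol mu (Gamma j))^-1.
    have [D [_ _ _ c0 _]] := covol_bounds hausG lcG scG haar_mu (latticeGamma j).
    by rewrite invr_ge0 ltW.
  have mc j : measurable_fun setT (fun o : borel (dual R G) =>
      ((covol mu (Gamma j))^-1 * normc (F (g j) o) ^+ 2)%:E).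
    apply/measurable_EFinP; apply: measurable_funM => //.
    by apply: eq_measurable_fun (mFg j) => o _; rewrite normc_sqr.
  rewrite (_ : sig%:E = \int[nu]_(o in (Z : set (borel (dual R G))))
     (\sum_(j <- J') ((covol mu (Gamma j))^-1 * normc (F (g j) o) ^+ 2)%:E))%E; last first.
    rewrite ge0_integral_sum//; last 2 first.
    - by move=> j; exact: measurable_funTS.
    - by move=> j o _; rewrite lee_fin mulr_ge0 ?sqr_ge0.
    rewrite /sig -sumEFin; apply: eq_bigr => j _.
    rewrite EFinM -(phiI j) (corr j).2 -ge0_integralZl_EFin//; last 2 first.
    - by move=> o _; rewrite lee_fin mulr_ge0 ?sqc_ge0.
    - exact/measurable_EFinP.
    rewrite [RHS]integral_mkcond; apply: eq_integral => o _.
    rewrite patchE indicE; case: ifPn => _ /=.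
      by rewrite mul1r -EFinM normc_sqr.
    by rewrite mul0r mule0.
  apply: ge0_le_integral => //.
  - by move=> o _; apply: sume_ge0 => j _; rewrite lee_fin mulr_ge0 ?sqr_ge0.
  - by apply: emeasurable_sum => j; exact: measurable_funTS.
  - apply: measurable_funTS; apply: measurable_esum => //; first exact: countableP.
    by move=> j o; rewrite lee_fin mulr_ge0 ?sqr_ge0.
  - move=> o _; apply: esum_ge; exists [set` J']; first by split=> //; exact: finite_fset.
    by rewrite fsbig_finite ?set_fsetK//; exact: finite_fset.
rewrite -(fineK (_ : nu Z \is a fin_num)) ?ge0_fin_numE// -EFinM.
apply: (@le_trans _ _ (m + sig)%:E); first by rewrite lee_fin.
by rewrite EFinD addeC leeD// lee_fin ltW.
Qed.

End Averaging.

Theorem theorem3p13 (R : realType) (G : topologicalZmodType)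
    (hausG : hausdorff_space G) (lcG : locally_compact [set: G])
    (scG : @second_countable G)
    (mu : {measure set (borel G) -> \bar R}) (haar_mu : haar_measure mu)
    (nu : {measure set (borel (dual R G)) -> \bar R}) (haar_nu : haar_measure nu)
    (F : (G -> R[i]) -> (dual R G -> R[i]))
    (planF : is_plancherel_transform mu nu F)
    (E : set (dual R G)) (closedE : closed E) (nullE : nu E = 0%E)
    (J : countType) (Gamma : J -> zmodClosed G)
    (latticeGamma : forall j, lattice (Gamma j))
    (g : J -> G -> R[i]) (gL2 : forall j, L2 mu (g j))
    (A B : R)
    (frame_g : is_frame mu [set p : J * G | p.2 \in Gamma p.1]
                 (fun p => translate p.2 (g p.1)) A B)
    (ucp_g : ucp1 mu nu F E Gamma g) :
  {ae nu, forall omega,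
     (A%:E <= \esum_(j in [set: J])
        ((covol mu (Gamma j))^-1 *
          ComplexField.Normc.normc (F (g j) omega) ^+ 2)%:E)%E}.
Proof.
pose S o := \esum_(j in [set: J])
  ((covol mu (Gamma j))^-1 * ComplexField.Normc.normc (F (g j) o) ^+ 2)%:E.
have cov0 j : 0 <= (covol mu (Gamma j))^-1.
  have [D [_ _ _ c0 _]] := covol_bounds hausG lcG scG haar_mu (latticeGamma j).
  by rewrite invr_ge0 ltW.
have S0 o : (0 <= S o)%E.
  by apply: esum_ge0 => j _; rewrite lee_fin mulr_ge0 ?sqr_ge0.
have A0 : 0 < A by case: frame_g.
have mS : measurable_fun setT (fun o : borel (dual R G) => S o).
  apply: measurable_esum; first exact: countableP.
    by move=> j o; rewrite lee_fin mulr_ge0 ?sqr_ge0.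
  move=> j _; apply/measurable_EFinP; apply: measurable_funM => //.
  have [mFg _] := plancherel_L2 planF (gL2 j).
  by apply: eq_measurable_fun (measurable_sqc mFg) => o _; rewrite normc_sqr.
have [K [cK KE EK]] := open_dual_sigma_compact scG closedE.
have hausD := @hausdorff_dual R G.
pose Z n k : set (dual R G) := K n k `&` [set o | (S o < A%:E)%E].
have mZ n k : measurable (Z n k : set (borel (dual R G))).
  apply: measurableI; first exact: borel_compact.
  rewrite -[X in measurable X]setTI; apply: emeasurable_fun_infty_o => //.
have nZ n k : nu.-negligible (Z n k : set (borel (dual R G))).
  have Zoo : (nu (Z n k) < +oo)%E.
    have [_ + _] := haar_nu => /(_ (K n k) (cK n k)); apply: le_lt_trans.
    by apply: le_measure; rewrite ?inE//; [exact: borel_compact|move=> o []].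
  have := mean_inequality hausG lcG scG haar_mu haar_nu planF latticeGamma gL2
    frame_g ucp_g (mZ n k) (cK n k) (@KE n k) (@subIsetl _ _ _).
  rewrite -/(S _) => AS.
  pose T o := (A%:E - S o)%E.
  have mT : measurable_fun (Z n k : set (borel (dual R G))) T.
    by apply: measurable_funTS; apply: emeasurable_funB.
  have SA o : Z n k o -> (S o < A%:E)%E by case.
  have T0 o : Z n k o -> (0 < T o)%E by move=> /SA; rewrite /T sube_gt0.
  have Sfin o : Z n k o -> S o \is a fin_num.
    by move=> /SA SAo; rewrite ge0_fin_numE//; apply: lt_trans SAo _; rewrite ltry.
  have int_split : (A%:E * nu (Z n k) =
      \int[nu]_(o in (Z n k : set (borel (dual R G)))) S o +
      \int[nu]_(o in (Z n k : set (borel (dual R G)))) T o)%E.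
    rewrite -ge0_integralD//.
    - rewrite -integral_cst//; apply: eq_integral => o /set_mem Zo /=.
      by rewrite /T addeC subeK//; exact: Sfin.
    - exact: measurable_funTS.
    - by move=> o /T0/ltW.
  have intSfin : (\int[nu]_(o in (Z n k : set (borel (dual R G)))) S o)%E \is a fin_num.
    rewrite ge0_fin_numE; last by apply: integral_ge0.
    apply: (@le_lt_trans _ _ (A%:E * nu (Z n k))%E).
      by rewrite int_split leeDl//; apply: integral_ge0 => o /T0/ltW.
    by rewrite lte_mul_pinfty// lee_fin ltW.
  have intT0 : (\int[nu]_(o in (Z n k : set (borel (dual R G)))) `|T o| = 0)%E.
    apply/eqP; rewrite eq_le; apply/andP; split; last by apply: integral_ge0.
    rewrite -(leeD2lE _ _ intSfin) adde0; apply: le_trans AS; rewrite int_split leeD2l//.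
    rewrite le_eqVlt; apply/orP; left; apply/eqP; apply: eq_integral => o /set_mem Zo.
    by rewrite gee0_abs//; exact/ltW/T0.
  have [+ _] := ae_eq_integral_abs nu (mZ n k) mT; move=> /(_ intT0).
  apply: negligibleS => o Zo /(_ Zo) To; have := T0 o Zo.
  by rewrite To /= ltxx.
have nE : nu.-negligible (E : set (borel (dual R G))).
  by apply/(negligibleP nu) => //; exact: borel_closed.
apply: (@negligibleS _ (borel (dual R G)) _ nu (E `|` \bigcup_n \bigcup_k Z n k)).
  move=> o /= /negP; rewrite -ltNge => SA.
  have [Eo|/EK[n _ [k _ Ko]]] := pselect (E o); first by left.
  by right; exists n => //; exists k.
apply: negligibleU => //.
by apply: negligible_bigcup => n; apply: negligible_bigcup => k.
Qed.
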